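(* Let $R$ be a Frobenius separable algebra (i.e. both Frobenius and separable) in a monoidal category $\mathcal{C}$ with coequalizers in which every object is coflat and left robust. Let $(\vartheta,e)$ be a Frobenius pair for $R$, let $\alpha:\underline{1}\to R$ be a morphism with $m_R(m_R\otimes\mathrm{Id}_R)(\mathrm{Id}_R\otimes\alpha\otimes\mathrm{Id}_R)e=\eta_R$, and let $(\rho,\lambda):Y\dashv X$ be an adjunction in $\mathcal{C}$. (i) If $Y$ has an $R$-bimodule structure $(\mu^R_Y,\nu^R_Y)$ in $\mathcal{C}$, then $X$ has an $R$-bimodule structure in $\mathcal{C}$ too, and via these structures the morphism $\rho_0:R\to X\otimes_RY$ defined as the composite $$\rho_0=q^R_{X,Y}\circ\big(\mathrm{Id}_X\otimes\mu^R_Y(\mathrm{Id}_R\otimes\nu^R_Y)\big)\circ(\mathrm{Id}_X\otimes\alpha\otimes\mathrm{Id}_{Y\otimes R})\circ(\rho\otimes\mathrm{Id}_R)$$ and the morphism $\lambda_0:Y\otimes_RX\to R$ uniquely determined by $$\lambda_0\,q^R_{Y,X}=(\mathrm{Id}_R\otimes\lambda)(\mathrm{Id}_R\otimes\mu^R_Y\otimes\mathrm{Id}_X)(e\otimes\mathrm{Id}_{Y\otimes X})$$ define an adjunction $(\rho_0,\lambda_0):Y\dashv X$ in ${}_R\mathcal{C}_R$. (ii) Similarly, if $X$ has an $R$-bimodule structure $(\mu^R_X,\nu^R_X)$ in $\mathcal{C}$, then $Y$ has an $R$-bimodule structure in $\mathcal{C}$ as well, and via these structures the morphism $\rho^0:R\to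 X\otimes_RY$ defined as the composite $$\rho^0=q^R_{X,Y}\circ\big(\mu^R_X(\mathrm{Id}_R\otimes\nu^R_X)\otimes\mathrm{Id}_Y\big)\circ(\mathrm{Id}_{R\otimes X}\otimes\alpha\otimes\mathrm{Id}_Y)\circ(\mathrm{Id}_R\otimes\rho)$$ and the morphism $\lambda^0:Y\otimes_RX\to R$ uniquely determined by $$\lambda^0\,q^R_{Y,X}=(\lambda\otimes\mathrm{Id}_R)(\mathrm{Id}_Y\otimes\nu^R_X\otimes\mathrm{Id}_R)(\mathrm{Id}_{Y\otimes X}\otimes e)$$ define an adjunction $(\rho^0,\lambda^0):Y\dashv X$ in ${}_R\mathcal{C}_R$.
   Context: Monoidal categories are taken strict, with tensor product $\otimes$ and unit object $\underline{1}$; $m_A,\eta_A$ denote multiplication and unit of an algebra $A$. An object $X$ is coflat if $X\otimes-$ and $-\otimes X$ preserve coequalizers. For a right $R$-module $(X,\nu^R_X)$ and a left $R$-module $(Y,\mu^R_Y)$, $q^R_{X,Y}:X\otimes Y\to X\otimes_RY$ is the coequalizer of $\nu^R_X\otimes\mathrm{Id}_Y$ and $\mathrm{Id}_X\otimes\mu^R_Y$. A left $R$-module $Y$ is left robust if for all objects $M$ and right $R$-modules $X$ the morphism $\theta'_{M,X,Y}:(M\otimes X)\otimes_RY\to M\otimes(X\otimes_RY)$ with $\theta'_{M,X,Y}q^R_{M\otimes X,Y}=\mathrm{Id}_M\otimes q^R_{X,Y}$ is an isomorphism; ''every object is left robust'' means this for every algebra $R$ and every left $R$-module. Under these hypotheses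 the category ${}_R\mathcal{C}_R$ of $R$-bimodules is monoidal with tensor product $\otimes_R$ ($X\otimes_RY$ having $R$-actions induced by the left action on $X$ and the right action on $Y$), unit object $R$, associativity constraint $\Sigma'_{M,X,Y}:(M\otimes_RX)\otimes_RY\to M\otimes_R(X\otimes_RY)$ determined by $\Sigma'_{M,X,Y}q^R_{M\otimes_RX,Y}(q^R_{M,X}\otimes\mathrm{Id}_Y)=q^R_{M,X\otimes_RY}(\mathrm{Id}_M\otimes q^R_{X,Y})$, and unit constraints induced by the actions. In a monoidal category (constraints suppressed) an adjunction $(\rho,\lambda):Y\dashv X$ consists of morphisms $\rho:\underline{1}\to X\otimes Y$ and $\lambda:Y\otimes X\to\underline{1}$ with $(\mathrm{Id}_X\otimes\lambda)(\rho\otimes\mathrm{Id}_X)=\mathrm{Id}_X$ and $(\lambda\otimes\mathrm{Id}_Y)(\mathrm{Id}_Y\otimes\rho)=\mathrm{Id}_Y$. A Frobenius pair $(\vartheta,e)$ for an algebra $R$ consists of $\vartheta:R\to\underline{1}$, $e:\underline{1}\to R\otimes R$ with $(m_R\otimes\mathrm{Id}_R)(\mathrm{Id}_R\otimes e)=(\mathrm{Id}_R\otimes m_R)(e\otimes\mathrm{Id}_R)$ and $(\vartheta\otimes\mathrm{Id}_R)e=\eta_R=(\mathrm{Id}_R\otimes\vartheta)e$; $R$ is Frobenius if it has a Frobenius pair. $R$ is separable if there is an $R$-bimodule morphism $\gamma:R\to R\otimes R$ with $m_R\gamma=\mathrm{Id}_R$. (For a Frobenius algebra, separability is equivalent to the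 existence of an $\alpha$ as in the claim.) *)

(* Defs.v *)
From Corelib Require Import ssreflect ssrfun.
From Stdlib Require Import Description ProofIrrelevance.

Set Implicit Arguments.
Unset Strict Implicit.
Unset Printing Implicit Defensive.

Declare Scope moncat_scope.
Delimit Scope moncat_scope with M.
Local Open Scope moncat_scope.

Record category := Category {
  ob :> Type;
  hom : ob -> ob -> Type;
  idm : forall X, hom X X;
  comp : forall X Y Z, hom Y Z -> hom X Y -> hom X Z;
  compA : forall W X Y Z (h : hom Y Z) (g : hom X Y) (f : hom W X),
    comp h (comp g f) = comp (comp h g) f;
  comp1m : forall X Y (f : hom X Y), comp (idm Y) f = f;
  compm1 : forall X Y (f : hom X Y), comp f (idm X) = f }.

Arguments idm {c} X.

Notation "'Id' X" := (idm X) (at level 10, X at level 9) : moncat_scope.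
Notation "g ∘ f" := (comp g f) (at level 40, left associativity) : moncat_scope.

(* Not assumed strict: associator [ass] and unitors [lun], [run] are explicit,
   with inverses [assi], [luni], [runi]. *)
Record moncat := Moncat {
  mcat :> category;
  one : mcat;
  ten : mcat -> mcat -> mcat;
  tenm : forall A B A' B' : mcat,
    hom A B -> hom A' B' -> hom (ten A A') (ten B B');
  ass : forall A B D, hom (ten (ten A B) D) (ten A (ten B D));
  assi : forall A B D, hom (ten A (ten B D)) (ten (ten A B) D);
  lun : forall A, hom (ten one A) A;
  luni : forall A, hom A (ten one A);
  run : forall A, hom (ten A one) A;
  runi : forall A, hom A (ten A one);
  tenm1 : forall A B, tenm (Id A) (Id B) = Id (ten A B);
  tenmM : forall A B D A' B' D' (g : hom B D) (f : hom A B)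
      (g' : hom B' D') (f' : hom A' B'),
    tenm (g ∘ f) (g' ∘ f') = tenm g g' ∘ tenm f f';
  assK : forall A B D, assi A B D ∘ ass A B D = Id _;
  assiK : forall A B D, ass A B D ∘ assi A B D = Id _;
  lunK : forall A, luni A ∘ lun A = Id _;
  luniK : forall A, lun A ∘ luni A = Id _;
  runK : forall A, runi A ∘ run A = Id _;
  runiK : forall A, run A ∘ runi A = Id _;
  ass_nat : forall A B D A' B' D' (f : hom A A') (g : hom B B') (h : hom D D'),
    ass A' B' D' ∘ tenm (tenm f g) h = tenm f (tenm g h) ∘ ass A B D;
  lun_nat : forall A A' (f : hom A A'), lun A' ∘ tenm (Id one) f = f ∘ lun A;
  run_nat : forall A A' (f : hom A A'), run A' ∘ tenm f (Id one) = f ∘ run A;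
  triangle : forall A B,
    tenm (Id A) (lun B) ∘ ass A one B = tenm (run A) (Id B);
  pentagon : forall A B D E,
    ass A B (ten D E) ∘ ass (ten A B) D E
    = tenm (Id A) (ass B D E) ∘ ass A (ten B D) E ∘ tenm (ass A B D) (Id E) }.

Arguments one {m}.
Arguments ass {m} A B D.
Arguments assi {m} A B D.
Arguments lun {m} A.
Arguments luni {m} A.
Arguments run {m} A.
Arguments runi {m} A.

Notation "𝟙" := one : moncat_scope.
Notation "A ⊗ B" := (ten A B) (at level 30, right associativity) : moncat_scope.
Notation "f ⊠ g" := (tenm f g) (at level 30, right associativity) : moncat_scope.

Definition is_iso (C : category) (X Y : C) (f : hom X Y) :=
  exists g : hom Y X, g ∘ f = Id X /\ f ∘ g = Id Y.

(* (ρ, λ) : Y ⊣ X, with Y the left adjoint. *)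
Record adjunction (C : moncat) (Y X : C)
    (rho : hom 𝟙 (X ⊗ Y)) (lam : hom (Y ⊗ X) 𝟙) : Prop := {
  adj_X : run X ∘ (Id X ⊠ lam) ∘ ass X Y X ∘ (rho ⊠ Id X) ∘ luni X = Id X;
  adj_Y : lun Y ∘ (lam ⊠ Id Y) ∘ assi Y X Y ∘ (Id Y ⊠ rho) ∘ runi Y = Id Y }.

Record is_coequalizer (C : category) (X Y Q : C) (f g : hom X Y)
    (q : hom Y Q) : Prop := {
  coeq_eq : q ∘ f = q ∘ g;
  coeq_univ : forall Z (h : hom Y Z), h ∘ f = h ∘ g ->
    exists! k : hom Q Z, k ∘ q = h }.

Record coequalizer (C : category) (X Y : C) (f g : hom X Y) := {
  coeq_ob : C;
  coeq_map : hom Y coeq_ob;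
  coeqP : is_coequalizer f g coeq_map }.

Definition has_coequalizers (C : category) :=
  forall (X Y : C) (f g : hom X Y), coequalizer f g.

Definition desc (C : category) (X Y Q : C) (f g : hom X Y) (q : hom Y Q)
    (P : is_coequalizer f g q) Z (h : hom Y Z) (E : h ∘ f = h ∘ g) : hom Q Z :=
  proj1_sig (constructive_definite_description _ (coeq_univ P E)).

Lemma descE (C : category) (X Y Q : C) (f g : hom X Y) (q : hom Y Q)
  (P : is_coequalizer f g q) Z (h : hom Y Z) (E : h ∘ f = h ∘ g) :
  desc P E ∘ q = h.
Proof. by rewrite /desc; case: constructive_definite_description. Qed.

Definition epi (C : category) (X Y : C) (f : hom X Y) :=
  forall Z (g h : hom Y Z), g ∘ f = h ∘ f -> g = h.

Lemma coeq_epi (C : category) (X Y Q : C) (f g : hom X Y) (q : hom Y Q) :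
  is_coequalizer f g q -> epi q.
Proof.
move=> P Z h k E.
have E' : (h ∘ q) ∘ f = (h ∘ q) ∘ g by rewrite -!compA (coeq_eq P).
have [u [_ U]] := coeq_univ P E'.
by rewrite -(U h) // -(U k).
Qed.

Definition regepi (C : category) (Y Q : C) (q : hom Y Q) :=
  exists (X : C) (f g : hom X Y), is_coequalizer f g q.

Lemma regepi_epi (C : category) (Y Q : C) (q : hom Y Q) : regepi q -> epi q.
Proof. by case=> X [f [g]]; exact: coeq_epi. Qed.

Definition coflat (C : moncat) (X : C) : Prop :=
  forall (A B Q : C) (f g : hom A B) (q : hom B Q), is_coequalizer f g q ->
    is_coequalizer (Id X ⊠ f) (Id X ⊠ g) (Id X ⊠ q) /\
    is_coequalizer (f ⊠ Id X) (g ⊠ Id X) (q ⊠ Id X).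

Section Calculus.
Context (C : moncat).
Implicit Types A B D E X Y Z : C.

Lemma epi_comp X Y Z (g : hom Y Z) (f : hom X Y) :
  epi g -> epi f -> epi (g ∘ f).
Proof. by move=> eg ef W h k; rewrite !compA => /ef /eg. Qed.

Lemma iso_mono X Y (f : hom X Y) (g : hom Y X) : g ∘ f = Id X ->
  forall Z (h k : hom Z X), f ∘ h = f ∘ k -> h = k.
Proof.
by move=> gf Z h k E; rewrite -(comp1m h) -(comp1m k) -gf -!compA E.
Qed.

Lemma iso_epi X Y (f : hom X Y) (g : hom Y X) : f ∘ g = Id Y -> epi f.
Proof.
by move=> fg Z h k E; rewrite -(compm1 h) -(compm1 k) -fg !compA E.
Qed.

Lemma rea X Y Z (g : hom Y Z) (f : hom X Y) (k : hom X Z) :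
  g ∘ f = k -> forall W (h : hom Z W), h ∘ g ∘ f = h ∘ k.
Proof. by move=> <- W h; rewrite compA. Qed.

Lemma wl A X Y Z (g : hom Y Z) (f : hom X Y) :
  Id A ⊠ (g ∘ f) = (Id A ⊠ g) ∘ (Id A ⊠ f).
Proof. by rewrite -tenmM comp1m. Qed.

Lemma wr A X Y Z (g : hom Y Z) (f : hom X Y) :
  (g ∘ f) ⊠ Id A = (g ⊠ Id A) ∘ (f ⊠ Id A).
Proof. by rewrite -tenmM comp1m. Qed.

Lemma xch A B X Y (f : hom A B) (g : hom X Y) :
  (f ⊠ Id Y) ∘ (Id A ⊠ g) = (Id B ⊠ g) ∘ (f ⊠ Id X).
Proof. by rewrite -!tenmM !comp1m !compm1. Qed.

Lemma tenE A B X Y (f : hom A B) (g : hom X Y) :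
  f ⊠ g = (f ⊠ Id Y) ∘ (Id A ⊠ g).
Proof. by rewrite -!tenmM !comp1m !compm1. Qed.

Lemma ass1 A B D A' (f : hom A A') :
  ass A' B D ∘ ((f ⊠ Id B) ⊠ Id D) = (f ⊠ Id (B ⊗ D)) ∘ ass A B D.
Proof. by rewrite ass_nat tenm1. Qed.

Lemma ass2 A B D B' (f : hom B B') :
  ass A B' D ∘ ((Id A ⊠ f) ⊠ Id D) = (Id A ⊠ (f ⊠ Id D)) ∘ ass A B D.
Proof. by rewrite ass_nat. Qed.

Lemma ass3 A B D D' (f : hom D D') :
  ass A B D' ∘ (Id (A ⊗ B) ⊠ f) = (Id A ⊠ (Id B ⊠ f)) ∘ ass A B D.
Proof. by rewrite -ass_nat tenm1. Qed.

Lemma assi_nat A B D A' B' D' (f : hom A A') (g : hom B B') (h : hom D D') :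
  assi A' B' D' ∘ (f ⊠ (g ⊠ h)) = ((f ⊠ g) ⊠ h) ∘ assi A B D.
Proof.
rewrite -[X in X = _]compm1 -(assiK A B D) !compA.
by rewrite (rea (esym (ass_nat f g h))) compA assK comp1m.
Qed.

Lemma assi1 A B D A' (f : hom A A') :
  assi A' B D ∘ (f ⊠ Id (B ⊗ D)) = ((f ⊠ Id B) ⊠ Id D) ∘ assi A B D.
Proof. by rewrite -assi_nat tenm1. Qed.

Lemma assi2 A B D B' (f : hom B B') :
  assi A B' D ∘ (Id A ⊠ (f ⊠ Id D)) = ((Id A ⊠ f) ⊠ Id D) ∘ assi A B D.
Proof. by rewrite assi_nat. Qed.

Lemma assi3 A B D D' (f : hom D D') :
  assi A B D' ∘ (Id A ⊠ (Id B ⊠ f)) = (Id (A ⊗ B) ⊠ f) ∘ assi A B D.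
Proof. by rewrite assi_nat tenm1. Qed.

Lemma luni_nat A A' (f : hom A A') : luni A' ∘ f = (Id 𝟙 ⊠ f) ∘ luni A.
Proof.
by rewrite -[_ ∘ f]compm1 -(luniK A) compA (rea (esym (lun_nat f))) compA
  lunK comp1m.
Qed.

Lemma runi_nat A A' (f : hom A A') : runi A' ∘ f = (f ⊠ Id 𝟙) ∘ runi A.
Proof.
by rewrite -[_ ∘ f]compm1 -(runiK A) compA (rea (esym (run_nat f))) compA
  runK comp1m.
Qed.

Lemma chain X Y Y' Z (g : hom Y Z) (f : hom X Y) (g' : hom Y' Z)
    (f' : hom X Y') :
  g ∘ f = g' ∘ f' -> forall W (h : hom Z W), h ∘ g ∘ f = h ∘ g' ∘ f'.
Proof. by move=> E W h; rewrite -!compA E. Qed.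

Definition assN := (ass1, ass2, ass3, assi1, assi2, assi3,
  fun A B D A' f => chain (@ass1 A B D A' f),
  fun A B D B' f => chain (@ass2 A B D B' f),
  fun A B D D' f => chain (@ass3 A B D D' f),
  fun A B D A' f => chain (@assi1 A B D A' f),
  fun A B D B' f => chain (@assi2 A B D B' f),
  fun A B D D' f => chain (@assi3 A B D D' f)).

Lemma pentagon2 A B D E :
  (ass A B D ⊠ Id E) ∘ assi (A ⊗ B) D E
  = assi A (B ⊗ D) E ∘ (Id A ⊠ assi B D E) ∘ ass A B (D ⊗ E).
Proof.
apply: (iso_epi (assiK _ _ _)).
rewrite (rea (assK _ _ _)) compm1 -[in RHS]compA pentagon !compA.
by rewrite (rea (esym (wl _ _ _))) assK tenm1 compm1 assK comp1m.
Qed.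

Lemma pentagon3 A B D E :
  ass (A ⊗ B) D E ∘ (assi A B D ⊠ Id E)
  = assi A B (D ⊗ E) ∘ (Id A ⊠ ass B D E) ∘ ass A (B ⊗ D) E.
Proof.
apply: (iso_mono (assK _ _ _)); rewrite !compA assiK comp1m pentagon.
by rewrite (rea (esym (wr _ _ _))) assiK tenm1 compm1.
Qed.

Lemma lun_faithful A B (f g : hom A B) : Id 𝟙 ⊠ f = Id 𝟙 ⊠ g -> f = g.
Proof.
move=> E; apply: (iso_epi (luniK A)).
by rewrite -!lun_nat E.
Qed.

Lemma run_faithful A B (f g : hom A B) : f ⊠ Id 𝟙 = g ⊠ Id 𝟙 -> f = g.
Proof.
move=> E; apply: (iso_epi (runiK A)).
by rewrite -!run_nat E.
Qed.

Lemma lun_ten A B : lun (A ⊗ B) ∘ ass 𝟙 A B = lun A ⊠ Id B.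
Proof.
apply: lun_faithful; rewrite wl.
apply: (iso_epi (g := (assi _ _ _ ⊠ Id _) ∘ assi _ _ _)
  (f := ass 𝟙 (𝟙 ⊗ A) B ∘ (ass 𝟙 𝟙 A ⊠ Id B))).
  by rewrite compA (rea (esym (wr _ _ _))) assiK tenm1 compm1 assiK.
rewrite !compA -2!(compA (Id 𝟙 ⊠ lun (A ⊗ B))) -pentagon.
by rewrite compA triangle -ass2 -compA -wr triangle ass1.
Qed.

Lemma run_ten A B : (Id A ⊠ run B) ∘ ass A B 𝟙 = run (A ⊗ B).
Proof.
apply: run_faithful; rewrite wr; apply: (iso_mono (assK _ _ _)).
rewrite compA ass2 -(triangle (A ⊗ B)) -(triangle B) wl compA ass3.
by rewrite -2!(compA (Id A ⊠ (Id B ⊠ lun 𝟙))) -pentagon !compA.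
Qed.

End Calculus.

Record algebra (C : moncat) := Algebra {
  aob :> C;
  mul : hom (aob ⊗ aob) aob;
  eta : hom 𝟙 aob;
  mulA : mul ∘ (mul ⊠ Id aob) = mul ∘ (Id aob ⊠ mul) ∘ ass aob aob aob;
  mul1m : mul ∘ (eta ⊠ Id aob) = lun aob;
  mulm1 : mul ∘ (Id aob ⊠ eta) = run aob }.

Arguments mul {C} a.
Arguments eta {C} a.

Record lmod_str (C : moncat) (R : algebra C) (Y : C) := LmodStr {
  lact : hom (R ⊗ Y) Y;
  lactA : lact ∘ (mul R ⊠ Id Y) = lact ∘ (Id R ⊠ lact) ∘ ass R R Y;
  lact1 : lact ∘ (eta R ⊠ Id Y) = lun Y }.

Record rmod_str (C : moncat) (R : algebra C) (X : C) := RmodStr {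
  ract : hom (X ⊗ R) X;
  ractA : ract ∘ (ract ⊠ Id R) = ract ∘ (Id X ⊠ mul R) ∘ ass X R R;
  ract1 : ract ∘ (Id X ⊠ eta R) = run X }.

Record bimod_str (C : moncat) (R : algebra C) (X : C) := BimodStr {
  blmod :> lmod_str R X;
  brmod :> rmod_str R X;
  bcomm : ract brmod ∘ (lact blmod ⊠ Id R)
          = lact blmod ∘ (Id R ⊠ ract brmod) ∘ ass R X R }.

Record bimod (C : moncat) (R : algebra C) := Bimod {
  bob :> C;
  bstr :> bimod_str R bob }.

Arguments Bimod {C R bob} bstr.

Record bimod_hom (C : moncat) (R : algebra C) (M N : bimod R) := BimodHom {
  bfun :> hom M N;
  bfunl : bfun ∘ lact M = lact N ∘ (Id R ⊠ bfun);
  bfunr : bfun ∘ ract M = ract N ∘ (bfun ⊠ Id R) }.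

Lemma bimod_hom_eq (C : moncat) (R : algebra C) (M N : bimod R)
  (f g : bimod_hom M N) : bfun f = bfun g -> f = g.
Proof.
case: f g => [f fl fr] [g gl gr] /= E; case: _ / E in gl gr *.
by rewrite (proof_irrelevance _ fl gl) (proof_irrelevance _ fr gr).
Qed.

Section Modules.
Context (C : moncat) (R : algebra C).
Implicit Types M X Y : C.

Definition lmod_reg : lmod_str R R := LmodStr (mulA R) (mul1m R).
Definition rmod_reg : rmod_str R R := RmodStr
  (ract := mul R) (mulA R) (mulm1 R).
Definition bimod_reg : bimod R :=
  Bimod (BimodStr (blmod := lmod_reg) (brmod := rmod_reg) (mulA R)).

Section FreeRmod.
Context (M X : C) (sX : rmod_str R X).
Let nu := (Id M ⊠ ract sX) ∘ ass M X R.

Fact free_rmodA :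
  nu ∘ (nu ⊠ Id R) = nu ∘ (Id (M ⊗ X) ⊠ mul R) ∘ ass (M ⊗ X) R R.
Proof.
rewrite /nu wr !compA !assN -wl ractA !wl.
by rewrite -[in RHS]compA pentagon !compA.
Qed.

Fact free_rmod1 : nu ∘ (Id (M ⊗ X) ⊠ eta R) = run (M ⊗ X).
Proof. by rewrite /nu assN -wl ract1 run_ten. Qed.

Definition free_rmod : rmod_str R (M ⊗ X) := RmodStr free_rmodA free_rmod1.
End FreeRmod.

Section FreeLmod.
Context (M X : C) (sX : lmod_str R X).
Let mu := (lact sX ⊠ Id M) ∘ assi R X M.

Fact free_lmodA :
  mu ∘ (mul R ⊠ Id (X ⊗ M)) = mu ∘ (Id R ⊠ mu) ∘ ass R R (X ⊗ M).
Proof.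
rewrite /mu wl !compA !assN -wr lactA !wr.
by rewrite (rea (pentagon2 _ _ _ _)) !compA.
Qed.

Fact free_lmod1 : mu ∘ (eta R ⊠ Id (X ⊗ M)) = lun (X ⊗ M).
Proof. by rewrite /mu assN -wr lact1 -lun_ten -compA assiK compm1. Qed.

Definition free_lmod : lmod_str R (X ⊗ M) := LmodStr free_lmodA free_lmod1.
End FreeLmod.

Fact outer_bimodP X Y (sX : lmod_str R X) (sY : rmod_str R Y) :
  ract (free_rmod X sY) ∘ (lact (free_lmod Y sX) ⊠ Id R)
  = lact (free_lmod Y sX) ∘ (Id R ⊠ ract (free_rmod X sY)) ∘ ass R (X ⊗ Y) R.
Proof.
rewrite /= wl wr !compA !assN xch -!compA; by rewrite pentagon3 !compA.
Qed.

Definition outer_bimod X Y (sX : lmod_str R X) (sY : rmod_str R Y) : bimod R :=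
  Bimod (BimodStr (outer_bimodP sX sY)).

End Modules.

Section TensorR.
Context (C : moncat) (cq : has_coequalizers C) (R : algebra C).

Section Def.
Context (X Y : C) (sX : rmod_str R X) (sY : lmod_str R Y).

Definition tenR_coeq := cq (ract sX ⊠ Id Y) ((Id X ⊠ lact sY) ∘ ass X R Y).
Definition tenR : C := coeq_ob tenR_coeq.
Definition quoR : hom (X ⊗ Y) tenR := coeq_map tenR_coeq.

Lemma quoRE :
  quoR ∘ (ract sX ⊠ Id Y) = quoR ∘ (Id X ⊠ lact sY) ∘ ass X R Y.
Proof. by rewrite /quoR (coeq_eq (coeqP tenR_coeq)) compA. Qed.

Lemma quoR_epi : epi quoR.
Proof. exact: coeq_epi (coeqP tenR_coeq). Qed.

Fact descR_wd Z (h : hom (X ⊗ Y) Z) :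
  h ∘ (ract sX ⊠ Id Y) = h ∘ (Id X ⊠ lact sY) ∘ ass X R Y ->
  h ∘ (ract sX ⊠ Id Y) = h ∘ ((Id X ⊠ lact sY) ∘ ass X R Y).
Proof. by rewrite compA. Qed.

Definition descR Z (h : hom (X ⊗ Y) Z) E : hom tenR Z :=
  desc (coeqP tenR_coeq) (descR_wd (h := h) E).

Lemma descRE Z (h : hom (X ⊗ Y) Z) E : descR (h := h) E ∘ quoR = h.
Proof. exact: descE. Qed.
End Def.

(* [theta] is the comparison morphism determined by
   [theta ∘ quoR = (Id M ⊠ quoR) ∘ ass]. *)
Section Theta.
Context (M X Y : C) (sX : rmod_str R X) (sY : lmod_str R Y).

Fact theta_wd : let h := (Id M ⊠ quoR sX sY) ∘ ass M X Y in
  h ∘ (ract (free_rmod M sX) ⊠ Id Y)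
  = h ∘ (Id (M ⊗ X) ⊠ lact sY) ∘ ass (M ⊗ X) R Y.
Proof.
rewrite /= wr !compA !assN -wl quoRE !wl.
by rewrite -[in RHS]compA pentagon !compA.
Qed.

Definition theta : hom (tenR (free_rmod M sX) sY) (M ⊗ tenR sX sY) :=
  descR theta_wd.
End Theta.

Definition left_robust (Y : C) (sY : lmod_str R Y) : Prop :=
  forall (M X : C) (sX : rmod_str R X), is_iso (theta M sX sY).

End TensorR.

Section BimodCat.
Context (C : moncat) (cq : has_coequalizers C)
  (cfl : forall X : C, coflat X) (R : algebra C).
Implicit Types M N X Y : bimod R.

Notation q X Y := (quoR cq (brmod X) (blmod Y)).
Notation fl X Y := (lact (free_lmod Y (blmod X))).
Notation fr X Y := (ract (free_rmod X (brmod Y))).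

Lemma reg_q X Y : regepi (q X Y).
Proof. by do 3 eexists; exact: (coeqP (tenR_coeq _ _ _)). Qed.

Lemma reg_l (A Y Z : C) (f : hom Y Z) : regepi f -> regepi (Id A ⊠ f).
Proof. by case=> X [g [h P]]; do 3 eexists; exact: (proj1 (cfl A P)). Qed.

Lemma reg_r (A Y Z : C) (f : hom Y Z) : regepi f -> regepi (f ⊠ Id A).
Proof. by case=> X [g [h P]]; do 3 eexists; exact: (proj2 (cfl A P)). Qed.

Ltac reg := apply: regepi_epi; repeat first
  [exact: reg_q | apply: reg_l | apply: reg_r].

Lemma bcommE X :
  lact X ∘ (Id R ⊠ ract X) = ract X ∘ (lact X ⊠ Id R) ∘ assi R X R.
Proof. by rewrite bcomm -!compA assiK compm1. Qed.

Section Tensor.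
Context (X Y : bimod R).

Fact tenR_lact_wd :
  (q X Y ∘ fl X Y) ∘ (Id R ⊠ (ract X ⊠ Id Y))
  = (q X Y ∘ fl X Y) ∘ (Id R ⊠ ((Id X ⊠ lact Y) ∘ ass X R Y)).
Proof.
rewrite /= wl !compA !assN (rea (esym (wr _ _ _))) bcommE !wr !compA quoRE.
rewrite !assN (rea (pentagon3 _ _ _ _)) !compA (rea (assiK _ _ _)) compm1.
by rewrite (chain (xch _ _)).
Qed.

Fact tenR_ract_wd :
  (q X Y ∘ fr X Y) ∘ ((ract X ⊠ Id Y) ⊠ Id R)
  = (q X Y ∘ fr X Y) ∘ (((Id X ⊠ lact Y) ∘ ass X R Y) ⊠ Id R).
Proof.
rewrite /= wr !compA !assN (chain (esym (xch _ _))) quoRE !assN.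
rewrite (rea (esym (wl _ (ract Y) (lact Y ⊠ Id R)))) bcomm !wl !compA.
by rewrite (rea (pentagon _ _ _ _)) !compA.
Qed.

Definition tenR_lact : hom (R ⊗ tenR cq X Y) (tenR cq X Y) :=
  desc (proj1 (cfl R (coeqP (tenR_coeq cq X Y)))) tenR_lact_wd.

Definition tenR_ract : hom (tenR cq X Y ⊗ R) (tenR cq X Y) :=
  desc (proj2 (cfl R (coeqP (tenR_coeq cq X Y)))) tenR_ract_wd.

Lemma tenR_lactE : tenR_lact ∘ (Id R ⊠ q X Y) = q X Y ∘ fl X Y.
Proof. exact: descE. Qed.

Lemma tenR_ractE : tenR_ract ∘ (q X Y ⊠ Id R) = q X Y ∘ fr X Y.
Proof. exact: descE. Qed.

Fact tenR_lactA : tenR_lact ∘ (mul R ⊠ Id (tenR cq X Y))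
  = tenR_lact ∘ (Id R ⊠ tenR_lact) ∘ ass R R (tenR cq X Y).
Proof.
have e : epi (Id (R ⊗ R) ⊠ q X Y) by reg.
apply: e; rewrite (chain (xch _ _)) tenR_lactE -compA lactA.
rewrite !assN (rea (esym (wl _ _ _))) tenR_lactE wl !compA tenR_lactE.
by rewrite -!compA.
Qed.

Fact tenR_lact1 : tenR_lact ∘ (eta R ⊠ Id (tenR cq X Y)) = lun _.
Proof.
have e : epi (Id 𝟙 ⊠ q X Y) by reg.
apply: e; rewrite (chain (xch _ _)) tenR_lactE -compA lact1.
by rewrite lun_nat.
Qed.

Fact tenR_ractA : tenR_ract ∘ (tenR_ract ⊠ Id R)
  = tenR_ract ∘ (Id (tenR cq X Y) ⊠ mul R) ∘ ass (tenR cq X Y) R R.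
Proof.
have e : epi ((q X Y ⊠ Id R) ⊠ Id R) by reg.
apply: e; rewrite (rea (esym (wr _ _ _))) tenR_ractE wr compA tenR_ractE.
rewrite -compA ractA !assN (chain (esym (xch _ _))) tenR_ractE.
by rewrite /= !compA !assN.
Qed.

Fact tenR_ract1 : tenR_ract ∘ (Id (tenR cq X Y) ⊠ eta R) = run _.
Proof.
have e : epi (q X Y ⊠ Id 𝟙) by reg.
apply: e; rewrite (chain (esym (xch _ _))) tenR_ractE -compA ract1.
by rewrite run_nat.
Qed.

Definition tenR_lmod : lmod_str R (tenR cq X Y) := LmodStr tenR_lactA tenR_lact1.
Definition tenR_rmod : rmod_str R (tenR cq X Y) := RmodStr tenR_ractA tenR_ract1.

Fact tenR_bcomm : ract tenR_rmod ∘ (lact tenR_lmod ⊠ Id R)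
  = lact tenR_lmod ∘ (Id R ⊠ ract tenR_rmod) ∘ ass R (tenR cq X Y) R.
Proof.
have e : epi ((Id R ⊠ q X Y) ⊠ Id R) by reg.
apply: e; rewrite /= (rea (esym (wr _ _ _))) tenR_lactE wr compA tenR_ractE.
rewrite -compA outer_bimodP !assN (rea (esym (wl _ _ _))) tenR_ractE wl !compA.
by rewrite tenR_lactE -!compA.
Qed.

Definition tenB : bimod R := Bimod (BimodStr tenR_bcomm).
End Tensor.

Notation "X ⊙ Y" := (tenB X Y) (at level 30, right associativity).

Definition quoB X Y : hom (X ⊗ Y) (X ⊙ Y) := q X Y.

Notation p X Y := (quoB X Y).

Lemma reg_p X Y : regepi (p X Y).
Proof. exact: reg_q. Qed.

Ltac regp := apply: regepi_epi; repeat first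
  [exact: reg_p | apply: reg_l | apply: reg_r].

Lemma lactE X Y : lact (X ⊙ Y) ∘ (Id R ⊠ p X Y) = p X Y ∘ fl X Y.
Proof. exact: tenR_lactE. Qed.

Lemma ractE X Y : ract (X ⊙ Y) ∘ (p X Y ⊠ Id R) = p X Y ∘ fr X Y.
Proof. exact: tenR_ractE. Qed.

Lemma q_eq X Y :
  p X Y ∘ (ract X ⊠ Id Y) = p X Y ∘ (Id X ⊠ lact Y) ∘ ass X R Y.
Proof. exact: quoRE. Qed.

Definition descB X Y (Z : C) (h : hom (X ⊗ Y) Z)
    (E : h ∘ (ract X ⊠ Id Y) = h ∘ (Id X ⊠ lact Y) ∘ ass X R Y) :
  hom (X ⊙ Y) Z := descR cq E.

Lemma descBE X Y (Z : C) (h : hom (X ⊗ Y) Z) E :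
  descB (h := h) E ∘ p X Y = h.
Proof. exact: descRE. Qed.

Definition bid X : bimod_hom X X.
Proof. by exists (Id X); rewrite comp1m tenm1 compm1. Defined.

Definition bcomp X Y Z (g : bimod_hom Y Z) (f : bimod_hom X Y) : bimod_hom X Z.
Proof.
exists (g ∘ f).
- by rewrite -compA bfunl compA bfunl wl compA.
- by rewrite -compA bfunr compA bfunr wr compA.
Defined.

Definition bimod_category : category.
Proof.
refine (@Category (bimod R) (@bimod_hom C R) bid bcomp _ _ _).
- by move=> *; apply: bimod_hom_eq; exact: compA.
- by move=> *; apply: bimod_hom_eq; exact: comp1m.
- by move=> *; apply: bimod_hom_eq; exact: compm1.
Defined.

Fact binv_l X Y (f : bimod_hom X Y) (g : hom Y X) :
  g ∘ f = Id X -> bfun f ∘ g = Id Y -> g ∘ lact Y = lact X ∘ (Id R ⊠ g).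
Proof.
move=> gf fg; rewrite -[LHS]compm1 -tenm1 -fg wl compA.
by rewrite (rea (esym (bfunl f))) !compA gf comp1m.
Qed.

Fact binv_r X Y (f : bimod_hom X Y) (g : hom Y X) :
  g ∘ f = Id X -> bfun f ∘ g = Id Y -> g ∘ ract Y = ract X ∘ (g ⊠ Id R).
Proof.
move=> gf fg; rewrite -[LHS]compm1 -tenm1 -fg wr compA.
by rewrite (rea (esym (bfunr f))) !compA gf comp1m.
Qed.

Definition binv X Y (f : bimod_hom X Y) (g : hom Y X)
    (gf : g ∘ f = Id X) (fg : bfun f ∘ g = Id Y) : bimod_hom Y X :=
  BimodHom (binv_l gf fg) (binv_r gf fg).

Section TensorHom.
Context (X X' Y Y' : bimod R) (f : bimod_hom X X') (g : bimod_hom Y Y').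

Fact btenm_wd : let h := p X' Y' ∘ (f ⊠ g) in
  h ∘ (ract X ⊠ Id Y) = h ∘ (Id X ⊠ lact Y) ∘ ass X R Y.
Proof.
rewrite /= (rea (esym (tenmM _ _ _ _))) (rea (esym (tenmM _ _ _ _))).
rewrite bfunr bfunl !compm1 -[X in _ ⊠ X](comp1m (bfun g)) -(comp1m (bfun f)).
rewrite !tenmM !compA q_eq comp1m -[X in _ = X]compA -ass_nat.
by rewrite !compA.
Qed.

Definition btenm_fun : hom (X ⊙ Y) (X' ⊙ Y') := descB btenm_wd.

Lemma btenm_funE : btenm_fun ∘ p X Y = p X' Y' ∘ (f ⊠ g).
Proof. exact: descBE. Qed.

Fact btenm_l :
  btenm_fun ∘ lact (X ⊙ Y) = lact (X' ⊙ Y') ∘ (Id R ⊠ btenm_fun).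
Proof.
have e : epi (Id R ⊠ p X Y) by regp.
apply: e; rewrite -compA lactE compA btenm_funE.
rewrite -[in RHS]compA -wl btenm_funE wl compA lactE -!compA; congr (_ ∘ _).
rewrite /= !compA -[in RHS]compA assi_nat !compA.
by rewrite -!tenmM !bfunl comp1m compm1.
Qed.

Fact btenm_r :
  btenm_fun ∘ ract (X ⊙ Y) = ract (X' ⊙ Y') ∘ (btenm_fun ⊠ Id R).
Proof.
have e : epi (p X Y ⊠ Id R) by regp.
apply: e; rewrite -compA ractE compA btenm_funE.
rewrite -[in RHS]compA -wr btenm_funE wr compA ractE -!compA; congr (_ ∘ _).
rewrite /= !compA -[in RHS]compA ass_nat !compA.
by rewrite -!tenmM !bfunr comp1m compm1.
Qed.

Definition btenm : bimod_hom (X ⊙ Y) (X' ⊙ Y') := BimodHom btenm_l btenm_r.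
End TensorHom.

Lemma btenmE X X' Y Y' (f : bimod_hom X X') (g : bimod_hom Y Y') :
  btenm f g ∘ p X Y = p X' Y' ∘ (f ⊠ g).
Proof. exact: btenm_funE. Qed.

Section Assoc.
Context (M X Y : bimod R).

Let h := p M (X ⊙ Y) ∘ (Id M ⊠ p X Y) ∘ ass M X Y.

Fact bass0_wd : h ∘ ((ract M ⊠ Id X) ⊠ Id Y)
  = h ∘ (((Id M ⊠ lact X) ∘ ass M R X) ⊠ Id Y).
Proof.
rewrite /h wr !compA !assN (chain (esym (xch _ _))) q_eq !assN.
rewrite (rea (esym (wl _ _ _))) lactE /= !wl !compA.
rewrite (rea (pentagon _ _ _ _)) !compA (rea (esym (wl _ (assi _ _ _) _))).
by rewrite assK tenm1 compm1.
Qed.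

Definition bass0 : hom ((M ⊙ X) ⊗ Y) (M ⊙ (X ⊙ Y)) :=
  desc (proj2 (cfl Y (coeqP (tenR_coeq cq M X)))) bass0_wd.

Lemma bass0E : bass0 ∘ (p M X ⊠ Id Y) = h.
Proof. exact: descE. Qed.

Fact bass_wd : bass0 ∘ (ract (M ⊙ X) ⊠ Id Y)
  = bass0 ∘ (Id (M ⊙ X) ⊠ lact Y) ∘ ass (M ⊙ X) R Y.
Proof.
have e : epi ((p M X ⊠ Id R) ⊠ Id Y) by regp.
apply: e; rewrite (rea (esym (wr _ _ _))) ractE wr compA bass0E.
rewrite !assN (chain (esym (xch _ _))) bass0E /h /= wr !compA !assN.
rewrite -(compA _ (Id M ⊠ p X Y) (Id M ⊠ (ract X ⊠ Id Y))) -wl q_eq !wl !compA.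
by rewrite (rea (pentagon _ _ _ _)) !compA.
Qed.

Definition bass_fun : hom ((M ⊙ X) ⊙ Y) (M ⊙ (X ⊙ Y)) := descB bass_wd.

Lemma bass_funE0 : bass_fun ∘ p (M ⊙ X) Y = bass0.
Proof. exact: descBE. Qed.

Lemma bass_funE : bass_fun ∘ p (M ⊙ X) Y ∘ (p M X ⊠ Id Y)
  = p M (X ⊙ Y) ∘ (Id M ⊠ p X Y) ∘ ass M X Y.
Proof. by rewrite bass_funE0 bass0E. Qed.

Let k := p (M ⊙ X) Y ∘ (p M X ⊠ Id Y) ∘ assi M X Y.

Fact bassi0_wd : k ∘ (Id M ⊠ (ract X ⊠ Id Y))
  = k ∘ (Id M ⊠ ((Id X ⊠ lact Y) ∘ ass X R Y)).
Proof.
rewrite /k wl !compA !assN (chain (xch _ _)).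
have E : p (M ⊙ X) Y ∘ (Id (M ⊙ X) ⊠ lact Y)
   = p (M ⊙ X) Y ∘ (ract (M ⊙ X) ⊠ Id Y) ∘ assi _ _ _.
  by rewrite q_eq -!compA assiK compm1.
rewrite E !assN (rea (esym (wr _ (ract (M ⊙ X)) _))) ractE /= !wr !compA.
rewrite (rea (pentagon2 _ _ _ _)) !compA (rea (assiK _ _ _)) compm1.
by rewrite (rea (esym (wl _ (assi _ _ _) _))) assK tenm1 compm1.
Qed.

Definition bassi0 : hom (M ⊗ (X ⊙ Y)) ((M ⊙ X) ⊙ Y) :=
  desc (proj1 (cfl M (coeqP (tenR_coeq cq X Y)))) bassi0_wd.

Lemma bassi0E : bassi0 ∘ (Id M ⊠ p X Y) = k.
Proof. exact: descE. Qed.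

Fact bassi_wd : bassi0 ∘ (ract M ⊠ Id (X ⊙ Y))
  = bassi0 ∘ (Id M ⊠ lact (X ⊙ Y)) ∘ ass M R (X ⊙ Y).
Proof.
have e : epi (Id (M ⊗ R) ⊠ p X Y) by regp.
apply: e; rewrite (chain (xch _ _)) bassi0E !assN.
rewrite (rea (esym (wl _ (lact (X ⊙ Y)) _))) lactE wl compA bassi0E /k /= !wl !compA !assN.
rewrite -(compA _ (p M X ⊠ Id Y) ((ract M ⊠ Id X) ⊠ Id Y)) -wr q_eq !wr !compA.
by rewrite (rea (pentagon2 _ _ _ _)) !compA.
Qed.

Definition bassi_fun : hom (M ⊙ (X ⊙ Y)) ((M ⊙ X) ⊙ Y) := descB bassi_wd.

Lemma bassi_funE : bassi_fun ∘ p M (X ⊙ Y) ∘ (Id M ⊠ p X Y)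
  = p (M ⊙ X) Y ∘ (p M X ⊠ Id Y) ∘ assi M X Y.
Proof. by rewrite descBE bassi0E. Qed.

Lemma epi_qq : epi (p (M ⊙ X) Y ∘ (p M X ⊠ Id Y)).
Proof. by apply: epi_comp; regp. Qed.

Lemma epi_qq' : epi (p M (X ⊙ Y) ∘ (Id M ⊠ p X Y)).
Proof. by apply: epi_comp; regp. Qed.

Lemma bassK : bassi_fun ∘ bass_fun = Id ((M ⊙ X) ⊙ Y).
Proof.
apply: epi_qq; rewrite comp1m compA -2!(compA bassi_fun) bass_funE.
by rewrite !compA bassi_funE (rea (assK _ _ _)) compm1.
Qed.

Lemma bassiK : bass_fun ∘ bassi_fun = Id (M ⊙ (X ⊙ Y)).
Proof.
apply: epi_qq'; rewrite comp1m compA -2!(compA bass_fun) bassi_funE.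
by rewrite !compA bass_funE (rea (assiK _ _ _)) compm1.
Qed.

Fact bass_l : bass_fun ∘ lact ((M ⊙ X) ⊙ Y)
  = lact (M ⊙ (X ⊙ Y)) ∘ (Id R ⊠ bass_fun).
Proof.
have e : epi ((Id R ⊠ p (M ⊙ X) Y) ∘ (Id R ⊠ (p M X ⊠ Id Y))).
  by apply: epi_comp; regp.
apply: e; rewrite !compA (rea (lactE _ _)) -2![in RHS]compA -!wl !compA.
rewrite bass_funE !wl !compA lactE /= !compA !assN.
rewrite (rea (esym (wr _ (lact (M ⊙ X)) _))) lactE /= !wr !compA bass_funE !assN.
rewrite (rea (pentagon3 _ _ _ _)) !compA (rea (assiK _ _ _)) compm1.
by rewrite (chain (xch _ _)).
Qed.

Fact bass_r : bass_fun ∘ ract ((M ⊙ X) ⊙ Y)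
  = ract (M ⊙ (X ⊙ Y)) ∘ (bass_fun ⊠ Id R).
Proof.
have e : epi ((p (M ⊙ X) Y ⊠ Id R) ∘ ((p M X ⊠ Id Y) ⊠ Id R)).
  by apply: epi_comp; regp.
apply: e; rewrite !compA (rea (ractE _ _)) -2![in RHS]compA -!wr !compA.
rewrite bass_funE !wr !compA ractE /= !compA !assN.
rewrite (rea (esym (wl _ (ract (X ⊙ Y)) _))) ractE /= !wl !compA.
rewrite (chain (esym (xch _ _))) bass_funE !assN.
by rewrite (rea (pentagon _ _ _ _)) !compA.
Qed.

Definition bass : bimod_hom ((M ⊙ X) ⊙ Y) (M ⊙ (X ⊙ Y)) :=
  BimodHom bass_l bass_r.
Definition bassi : bimod_hom (M ⊙ (X ⊙ Y)) ((M ⊙ X) ⊙ Y) :=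
  binv (f := bass) bassK bassiK.

End Assoc.

Section Unitors.
Context (X : bimod R).
Notation R0 := (bimod_reg R).

Fact blun_wd : lact X ∘ (ract R0 ⊠ Id X)
  = lact X ∘ (Id R0 ⊠ lact X) ∘ ass R0 R X.
Proof. exact: lactA. Qed.

Definition blun_fun : hom (R0 ⊙ X) X := descB (X := R0) blun_wd.
Definition bluni_fun : hom X (R0 ⊙ X) :=
  p R0 X ∘ (eta R ⊠ Id X) ∘ luni X.

Lemma blun_funE : blun_fun ∘ p R0 X = lact X.
Proof. exact: descBE. Qed.

Lemma blunK : bluni_fun ∘ blun_fun = Id (R0 ⊙ X).
Proof.
have e : epi (p R0 X) by regp.
apply: e; rewrite comp1m -compA blun_funE /bluni_fun (rea (luni_nat _)) !compA.
rewrite (chain (xch _ _)) -[p R0 X ∘ _]compm1 -[Id (R0 ⊗ X)]tenm1.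
have E : p R0 X ∘ (Id R0 ⊠ lact X)
   = p R0 X ∘ (ract R0 ⊠ Id X) ∘ assi _ _ _.
  by rewrite (q_eq R0) -!compA assiK compm1.
rewrite tenm1 compm1 E !assN (rea (esym (wr _ (mul R) _))) mul1m -lun_ten.
by rewrite !compA (rea (assiK _ _ _)) compm1 (rea (luniK _)) compm1.
Qed.

Lemma bluniK : blun_fun ∘ bluni_fun = Id X.
Proof. by rewrite /bluni_fun !compA blun_funE lact1 luniK. Qed.

Fact blun_l : blun_fun ∘ lact (R0 ⊙ X) = lact X ∘ (Id R ⊠ blun_fun).
Proof.
have e : epi (Id R ⊠ p R0 X) by regp.
apply: e; rewrite (rea (lactE _ _)) (rea (esym (wl _ _ _))) compA blun_funE /=.
by rewrite compA lactA -compA assiK compm1.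
Qed.

Fact blun_r : blun_fun ∘ ract (R0 ⊙ X) = ract X ∘ (blun_fun ⊠ Id R).
Proof.
have e : epi (p R0 X ⊠ Id R) by regp.
apply: e; rewrite (rea (ractE _ _)) (rea (esym (wr _ _ _))) compA blun_funE /=.
by rewrite compA bcomm.
Qed.

Definition blun : bimod_hom (R0 ⊙ X) X := BimodHom blun_l blun_r.
Definition bluni : bimod_hom X (R0 ⊙ X) := binv (f := blun) blunK bluniK.

Fact brun_wd : ract X ∘ (ract X ⊠ Id R0)
  = ract X ∘ (Id X ⊠ lact R0) ∘ ass X R R0.
Proof. exact: ractA. Qed.

Definition brun_fun : hom (X ⊙ R0) X := descB (Y := R0) brun_wd.
Definition bruni_fun : hom X (X ⊙ R0) :=
  p X R0 ∘ (Id X ⊠ eta R) ∘ runi X.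

Lemma brun_funE : brun_fun ∘ p X R0 = ract X.
Proof. exact: descBE. Qed.

Lemma brunK : bruni_fun ∘ brun_fun = Id (X ⊙ R0).
Proof.
have e : epi (p X R0) by regp.
apply: e; rewrite comp1m -compA brun_funE /bruni_fun (rea (runi_nat _)) !compA.
rewrite (chain (esym (xch _ _))) (q_eq X R0) !assN.
rewrite (rea (esym (wl _ (mul R) _))) mulm1 (rea (run_ten _ _)).
by rewrite (rea (runiK _)) compm1.
Qed.

Lemma bruniK : brun_fun ∘ bruni_fun = Id X.
Proof. by rewrite /bruni_fun !compA brun_funE ract1 runiK. Qed.

Fact brun_l : brun_fun ∘ lact (X ⊙ R0) = lact X ∘ (Id R ⊠ brun_fun).
Proof.
have e : epi (Id R ⊠ p X R0) by regp.
apply: e; rewrite (rea (lactE _ _)) (rea (esym (wl _ _ _))) compA brun_funE /=.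
by rewrite compA bcomm -compA assiK compm1.
Qed.

Fact brun_r : brun_fun ∘ ract (X ⊙ R0) = ract X ∘ (brun_fun ⊠ Id R).
Proof.
have e : epi (p X R0 ⊠ Id R) by regp.
apply: e; rewrite (rea (ractE _ _)) (rea (esym (wr _ _ _))) compA brun_funE /=.
by rewrite compA ractA.
Qed.

Definition brun : bimod_hom (X ⊙ R0) X := BimodHom brun_l brun_r.
Definition bruni : bimod_hom X (X ⊙ R0) := binv (f := brun) brunK bruniK.
End Unitors.

Lemma bidE X : bfun (bid X) = Id X.
Proof. by []. Qed.

Lemma btenm1 X Y : btenm_fun (bid X) (bid Y) = Id (X ⊙ Y).
Proof.
have e : epi (p X Y) by regp.
by apply: e; rewrite btenm_funE tenm1 compm1 comp1m.
Qed.

Lemma btenmM X Y Z X' Y' Z' (g : bimod_hom Y Z) (f : bimod_hom X Y)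
    (g' : bimod_hom Y' Z') (f' : bimod_hom X' Y') :
  btenm_fun (bcomp g f) (bcomp g' f') = btenm_fun g g' ∘ btenm_fun f f'.
Proof.
have e : epi (p X X') by regp.
apply: e; rewrite btenm_funE -compA btenm_funE compA btenm_funE.
by rewrite tenmM compA.
Qed.

Lemma bass_nat M X Y M' X' Y' (f : bimod_hom M M') (g : bimod_hom X X')
    (h : bimod_hom Y Y') :
  bass_fun M' X' Y' ∘ btenm_fun (btenm f g) h
  = btenm_fun f (btenm g h) ∘ bass_fun M X Y.
Proof.
apply: epi_qq.
rewrite !compA (rea (btenm_funE _ _)) -!compA -tenmM btenmE compm1.
rewrite -[X in _ ⊠ X](comp1m (bfun h)) tenmM !compA bass_funE -compA ass_nat.
rewrite -2![in RHS](compA (btenm_fun f (btenm g h))) bass_funE !compA.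
rewrite btenm_funE -!compA; congr (_ ∘ _).
by rewrite !compA -!tenmM compm1 comp1m btenmE.
Qed.

Lemma blun_nat X Y (f : bimod_hom X Y) :
  blun_fun Y ∘ btenm_fun (bid (bimod_reg R)) f = f ∘ blun_fun X.
Proof.
have e : epi (p (bimod_reg R) X) by regp.
by apply: e; rewrite (rea (btenm_funE _ _)) compA blun_funE -compA blun_funE
  bfunl.
Qed.

Lemma brun_nat X Y (f : bimod_hom X Y) :
  brun_fun Y ∘ btenm_fun f (bid (bimod_reg R)) = f ∘ brun_fun X.
Proof.
have e : epi (p X (bimod_reg R)) by regp.
by apply: e; rewrite (rea (btenm_funE _ _)) compA brun_funE -compA brun_funE
  bfunr.
Qed.

Lemma btriangle X Y :
  btenm_fun (bid X) (blun Y) ∘ bass_fun X (bimod_reg R) Y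
  = btenm_fun (brun X) (bid Y).
Proof.
apply: epi_qq.
rewrite -compA (compA (bass_fun _ _ _)) bass_funE !compA !btenm_funE.
rewrite -(compA _ (Id X ⊠ blun Y)) -wl blun_funE.
by rewrite -(compA _ (brun X ⊠ Id Y)) -wr brun_funE q_eq.
Qed.

Lemma bpentagon X Y Z T :
  bass_fun X Y (Z ⊙ T) ∘ bass_fun (X ⊙ Y) Z T
  = btenm_fun (bid X) (bass Y Z T) ∘ bass_fun X (Y ⊙ Z) T
    ∘ btenm_fun (bass X Y Z) (bid T).
Proof.
have e : epi (p ((X ⊙ Y) ⊙ Z) T ∘ (p (X ⊙ Y) Z ⊠ Id T)
              ∘ ((p X Y ⊠ Id Z) ⊠ Id T)).
  by do 2 (apply: epi_comp; last by regp); regp.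
apply: e.
rewrite !compA -2!(compA (bass_fun X Y (Z ⊙ T))) bass_funE !compA !assN.
rewrite (chain (esym (xch _ _))) bass_funE !assN.
rewrite (rea (btenm_funE _ _)) !compA !bidE.
rewrite (rea (esym (wr T (bass X Y Z) _))) (rea (esym (wr T _ (p X Y ⊠ Id Z)))).
rewrite bass_funE !wr !compA -2!(compA (btenm_fun _ _)) bass_funE.
rewrite !compA !assN btenm_funE bidE.
rewrite (rea (esym (wl X (bass Y Z T) _))) (rea (esym (wl X _ (p Y Z ⊠ Id T)))).
rewrite bass_funE !wl !compA.
by rewrite -[in LHS]compA pentagon !compA.
Qed.

(* The constraints are pinned down by [bass_funE], [blun_funE] and [brun_funE];
   the actions on [X ⊙ Y] by [lactE] and [ractE]. *)
Definition bimod_moncat : moncat.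
Proof.
refine (@Moncat bimod_category (bimod_reg R) tenB btenm bass bassi
  blun bluni brun bruni _ _ _ _ _ _ _ _ _ _ _ _ _);
  intros; apply: bimod_hom_eq.
- exact: btenm1.
- exact: btenmM.
- exact: bassK.
- exact: bassiK.
- exact: blunK.
- exact: bluniK.
- exact: brunK.
- exact: bruniK.
- exact: bass_nat.
- exact: blun_nat.
- exact: brun_nat.
- exact: btriangle.
- exact: bpentagon.
Defined.
End BimodCat.

Record frobenius_pair (C : moncat) (R : algebra C)
    (vartheta : hom R 𝟙) (e : hom 𝟙 (R ⊗ R)) : Prop := {
  frob_casimir :
    (mul R ⊠ Id R) ∘ assi R R R ∘ (Id R ⊠ e) ∘ runi R
    = (Id R ⊠ mul R) ∘ ass R R R ∘ (e ⊠ Id R) ∘ luni R;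
  frob_l : lun R ∘ (vartheta ⊠ Id R) ∘ e = eta R;
  frob_r : run R ∘ (Id R ⊠ vartheta) ∘ e = eta R }.

Definition frobenius (C : moncat) (R : algebra C) : Prop :=
  exists (vartheta : hom R 𝟙) (e : hom 𝟙 (R ⊗ R)), frobenius_pair vartheta e.

Definition separable (C : moncat) (R : algebra C) : Prop :=
  exists gamma : bimod_hom (bimod_reg R) (outer_bimod (lmod_reg R) (rmod_reg R)),
    mul R ∘ gamma = Id R.

(* Main.v *)
From Corelib Require Import ssreflect ssrfun.
Require Import Defs.

(* Write [e = e1 ⊗ e2]. In (i) the [R]-actions on [X] are the mates of those on
   [Y], determined by [λ(y, r x) = λ(y r, x)] and [λ(y, x r) = ϑ(λ'(y, x) r)]
   where [λ'(y, x) = e1 λ(e2 y, x)]. The Casimir property of [e] makes [λ'] left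
   linear, and with [e1 ϑ(e2 s) = s] also right linear; [λ'] is balanced, so it
   descends to [λ0]. Likewise [ρ'(r) = x_i ⊗ α y_i r], for [ρ = x_i ⊗ y_i], is
   a bimodule map [R -> X ⊗ Y], and [ρ0] is its composite with the quotient map.
   The triangle identities of [(ρ0, λ0)] lift along the quotient maps to
   identities in [C] between [ρ'] and [λ'], which follow from [e1 α e2 = η].
   (ii) is (i) in the monoidal category with reversed tensor product. *)

Set Implicit Arguments.
Unset Strict Implicit.
Unset Printing Implicit Defensive.

Local Open Scope moncat_scope.

(** * Strictification *)

Section Strictification.
Context (C : moncat).
Implicit Types A B X Y Z W : C.

Inductive tree := Leaf (A : C) | Unit | Node (s t : tree).

Fixpoint ev (t : tree) : C :=
  match t with Leaf A => A | Unit => 𝟙 | Node s u => ev s ⊗ ev u end.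

(* As endofunctors of [C], the words of objects are strictly associative: [nf t]
   tensors from the left by the leaves of [t], one at a time, and [hat] turns a
   morphism [f] into the transformation [f ⊗ -] between such functors. *)
Fixpoint nf (t : tree) (Z : C) : C :=
  match t with Leaf A => A ⊗ Z | Unit => Z | Node s u => nf s (nf u Z) end.

Fixpoint nfm (t : tree) Z W (h : hom Z W) : hom (nf t Z) (nf t W) :=
  match t with
  | Leaf A => Id A ⊠ h | Unit => h | Node s u => nfm s (nfm u h)
  end.

(** The coherence isomorphism that brackets to the right and deletes units; [kapi] is its
    inverse. *)
Fixpoint kap (t : tree) Z : hom (ev t ⊗ Z) (nf t Z) :=
  match t with
  | Leaf A => Id (A ⊗ Z)
  | Unit => lun Z
  | Node s u => kap s (nf u Z) ∘ (Id (ev s) ⊠ kap u Z) ∘ ass (ev s) (ev u) Z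
  end.

Fixpoint kapi (t : tree) Z : hom (nf t Z) (ev t ⊗ Z) :=
  match t with
  | Leaf A => Id (A ⊗ Z)
  | Unit => luni Z
  | Node s u => assi (ev s) (ev u) Z ∘ (Id (ev s) ⊠ kapi u Z) ∘ kapi s (nf u Z)
  end.

Lemma nfm_id t Z : nfm t (Id Z) = Id (nf t Z).
Proof. by elim: t Z => [A|//|s IHs u IHu] Z /=; rewrite ?tenm1 ?IHu ?IHs. Qed.

Lemma kapK t Z : kapi t Z ∘ kap t Z = Id _.
Proof.
elim: t Z => [A|//|s IHs u IHu] Z /=; rewrite ?comp1m ?lunK //.
rewrite !compA (rea (IHs _)) compm1 (rea (esym (wl _ _ _))) IHu tenm1 compm1.
exact: assK.
Qed.

Lemma kapiK t Z : kap t Z ∘ kapi t Z = Id _.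
Proof.
elim: t Z => [A|//|s IHs u IHu] Z /=; rewrite ?comp1m ?luniK //.
rewrite !compA (rea (assiK _ _ _)) compm1 (rea (esym (wl _ _ _))) IHu tenm1 compm1.
exact: IHs.
Qed.

Lemma kap_nat t Z W (h : hom Z W) :
  nfm t h ∘ kap t Z = kap t W ∘ (Id (ev t) ⊠ h).
Proof.
elim: t Z W h => [A|//|s IHs u IHu] Z W h /=.
- by rewrite comp1m compm1.
- by rewrite lun_nat.
- rewrite !compA IHs !assN -[in LHS]compA -[in LHS]compA.
  by rewrite [X in _ ∘ X]compA -wl IHu wl !compA.
Qed.

Lemma kapi_nat t Z W (h : hom Z W) :
  kapi t W ∘ nfm t h = (Id (ev t) ⊠ h) ∘ kapi t Z.
Proof.
rewrite -[LHS]compm1 -(kapiK t Z) !compA (rea (kap_nat _ _)) compA kapK.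
by rewrite comp1m.
Qed.

(* Locked, so that unification does not look for composites or tensors inside. *)
Fact hat_key : unit. Proof. exact: tt. Qed.

Definition hat (s t : tree) (f : hom (ev s) (ev t)) Z : hom (nf s Z) (nf t Z) :=
  locked_with hat_key (kap t Z ∘ (f ⊠ Id Z) ∘ kapi s Z).

Lemma hat_unlock s t (f : hom (ev s) (ev t)) Z :
  @hat s t f Z = kap t Z ∘ (f ⊠ Id Z) ∘ kapi s Z.
Proof. by rewrite /hat unlock. Qed.

(** As [kap] and [kapi] are invertible, the component at [𝟙] determines [f ⊠ Id 𝟙], and tensoring
    with [𝟙] is faithful. *)
Lemma hat_inj (s t : tree) (f g : hom (ev s) (ev t)) :
  (forall Z, @hat s t f Z = @hat s t g Z) -> f = g.
Proof.
move/(_ 𝟙) => E; apply: run_faithful.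
apply: (iso_mono (kapK t 𝟙)).
rewrite -[LHS]compm1 -[RHS]compm1 -(kapK s) !compA.
by rewrite !hat_unlock in E; rewrite E.
Qed.

Lemma hat_nat s t (f : hom (ev s) (ev t)) Z W (h : hom Z W) :
  nfm t h ∘ hat f Z = @hat s t f W ∘ nfm s h.
Proof.
rewrite !hat_unlock !compA kap_nat (rea (kapi_nat _ _)) !compA.
by rewrite (chain (xch _ _)).
Qed.

Lemma hat_id s Z : @hat s s (Id (ev s)) Z = Id (nf s Z).
Proof. by rewrite hat_unlock tenm1 compm1 kapiK. Qed.

Lemma hat_comp s t u (g : hom (ev t) (ev u)) (f : hom (ev s) (ev t)) Z :
  @hat s u (g ∘ f) Z = @hat t u g Z ∘ @hat s t f Z.
Proof.
by rewrite !hat_unlock wr !compA (rea (kapK _ _)) compm1.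
Qed.

Lemma hat_ten s t s' t' (f : hom (ev s) (ev t)) (g : hom (ev s') (ev t')) Z :
  @hat (Node s s') (Node t t') (f ⊠ g) Z
  = hat f (nf t' Z) ∘ nfm s (hat g Z).
Proof.
rewrite !hat_unlock -[in RHS]compA kapi_nat !wl /= !compA.
rewrite -(compA _ (ass _ _ _)) ass_nat !compA (rea (assiK _ _ _)) compm1.
by rewrite [f ⊠ _]tenE !compA (chain (xch f (kap t' Z))).
Qed.

(** Source and target have the same normal form, and the pentagon says that the associator is
    compatible with the two coherence isomorphisms onto it. *)
Lemma hat_ass s t u Z :
  @hat (Node (Node s t) u) (Node s (Node t u)) (ass (ev s) (ev t) (ev u)) Z
  = Id _.
Proof.
rewrite -(kapiK (Node (Node s t) u)) hat_unlock; congr (_ ∘ _) => /=.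
rewrite !wl !compA !assN.
by rewrite -2!(compA (kap s _ ∘ _ ∘ _)) -pentagon compA.
Qed.

Lemma hat_assi s t u Z :
  @hat (Node s (Node t u)) (Node (Node s t) u) (assi (ev s) (ev t) (ev u)) Z
  = Id _.
Proof.
have := @hat_comp (Node (Node s t) u) (Node s (Node t u)) (Node (Node s t) u)
  (assi (ev s) (ev t) (ev u)) (ass (ev s) (ev t) (ev u)) Z.
by rewrite assK (@hat_id (Node (Node s t) u)) hat_ass compm1 => <-.
Qed.

Lemma hat_lun t Z : @hat (Node Unit t) t (lun (ev t)) Z = Id _.
Proof.
by rewrite -(kapiK (Node Unit t)) hat_unlock /= -lun_ten lun_nat !compA.
Qed.

Lemma hat_luni t Z : @hat t (Node Unit t) (luni (ev t)) Z = Id _.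
Proof.
have := @hat_comp t (Node Unit t) t (lun (ev t)) (luni (ev t)) Z.
by rewrite luniK hat_id hat_lun comp1m => <-.
Qed.

Lemma hat_run t Z : @hat (Node t Unit) t (run (ev t)) Z = Id _.
Proof.
by rewrite -(kapiK (Node t Unit)) hat_unlock /= -triangle !compA.
Qed.

Lemma hat_runi t Z : @hat t (Node t Unit) (runi (ev t)) Z = Id _.
Proof.
have := @hat_comp t (Node t Unit) t (run (ev t)) (runi (ev t)) Z.
by rewrite runiK hat_id hat_run comp1m => <-.
Qed.

End Strictification.

Arguments Unit {C}.

(** * Strictified morphisms with at most two tensor factors on each side *)

Section Shapes.
Context (C : moncat).
Implicit Types A B D Z W : C.

(* [hij f] is [hat f] for [f] with [i] tensor factors in its source and [j] in
   its target. *)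
Definition h01 A (f : hom 𝟙 A) Z : hom Z (A ⊗ Z) := @hat C Unit (Leaf A) f Z.
Definition h10 A (f : hom A 𝟙) Z : hom (A ⊗ Z) Z := @hat C (Leaf A) Unit f Z.
Definition h11 A B (f : hom A B) Z : hom (A ⊗ Z) (B ⊗ Z) :=
  @hat C (Leaf A) (Leaf B) f Z.
Definition h02 A B (f : hom 𝟙 (A ⊗ B)) Z : hom Z (A ⊗ B ⊗ Z) :=
  @hat C Unit (Node (Leaf A) (Leaf B)) f Z.
Definition h20 A B (f : hom (A ⊗ B) 𝟙) Z : hom (A ⊗ B ⊗ Z) Z :=
  @hat C (Node (Leaf A) (Leaf B)) Unit f Z.
Definition h12 A B D (f : hom D (A ⊗ B)) Z : hom (D ⊗ Z) (A ⊗ B ⊗ Z) :=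
  @hat C (Leaf D) (Node (Leaf A) (Leaf B)) f Z.
Definition h21 A B D (f : hom (A ⊗ B) D) Z : hom (A ⊗ B ⊗ Z) (D ⊗ Z) :=
  @hat C (Node (Leaf A) (Leaf B)) (Leaf D) f Z.

(** The [nat] lemmas are the interchange law: [f] acts on the leading factors, [h] on the rest. *)
Lemma nat01 A (f : hom 𝟙 A) Z W (h : hom Z W) :
  (Id A ⊠ h) ∘ h01 f Z = h01 f W ∘ h.
Proof. exact: (@hat_nat C Unit (Leaf A)). Qed.

Lemma nat10 A (f : hom A 𝟙) Z W (h : hom Z W) :
  h ∘ h10 f Z = h10 f W ∘ (Id A ⊠ h).
Proof. exact: (@hat_nat C (Leaf A) Unit). Qed.

Lemma nat02 A B (f : hom 𝟙 (A ⊗ B)) Z W (h : hom Z W) :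
  (Id A ⊠ (Id B ⊠ h)) ∘ h02 f Z = h02 f W ∘ h.
Proof. exact: (@hat_nat C Unit (Node (Leaf A) (Leaf B))). Qed.

Lemma nat20 A B (f : hom (A ⊗ B) 𝟙) Z W (h : hom Z W) :
  h ∘ h20 f Z = h20 f W ∘ (Id A ⊠ (Id B ⊠ h)).
Proof. exact: (@hat_nat C (Node (Leaf A) (Leaf B)) Unit). Qed.

Lemma nat21 A B D (f : hom (A ⊗ B) D) Z W (h : hom Z W) :
  (Id D ⊠ h) ∘ h21 f Z = h21 f W ∘ (Id A ⊠ (Id B ⊠ h)).
Proof. exact: (@hat_nat C (Node (Leaf A) (Leaf B)) (Leaf D)). Qed.

Lemma hat01E A (f : hom 𝟙 A) Z : @hat C Unit (Leaf A) f Z = h01 f Z.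
Proof. by []. Qed.
Lemma hat10E A (f : hom A 𝟙) Z : @hat C (Leaf A) Unit f Z = h10 f Z.
Proof. by []. Qed.
Lemma hat11E A B (f : hom A B) Z : @hat C (Leaf A) (Leaf B) f Z = h11 f Z.
Proof. by []. Qed.
Lemma hat02E A B (f : hom 𝟙 (A ⊗ B)) Z :
  @hat C Unit (Node (Leaf A) (Leaf B)) f Z = h02 f Z.
Proof. by []. Qed.
Lemma hat20E A B (f : hom (A ⊗ B) 𝟙) Z :
  @hat C (Node (Leaf A) (Leaf B)) Unit f Z = h20 f Z.
Proof. by []. Qed.
Lemma hat12E A B D (f : hom D (A ⊗ B)) Z :
  @hat C (Leaf D) (Node (Leaf A) (Leaf B)) f Z = h12 f Z.
Proof. by []. Qed.
Lemma hat21E A B D (f : hom (A ⊗ B) D) Z :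
  @hat C (Node (Leaf A) (Leaf B)) (Leaf D) f Z = h21 f Z.
Proof. by []. Qed.

End Shapes.

Definition hatE := (hat01E, hat10E, hat11E, hat02E, hat20E, hat12E, hat21E).
Definition hatM := (hat_ten, hat_ass, hat_assi, hat_lun, hat_luni, hat_run,
  hat_runi, hat_id).

(** * Translation of equations into strictified form *)

Ltac tree_of X :=
  lazymatch X with
  | ten ?A ?B => let s := tree_of A in let t := tree_of B in constr:(Node s t)
  | @one ?C => constr:(@Unit C)
  | _ => constr:(Leaf X)
  end.

(** The bracketing of each intermediate object of a composite is read off its type. *)
Ltac push :=
  repeat match goal with
  | |- context [@hat ?C ?s ?u (@comp _ _ ?B _ ?g ?f) ?Z] =>
      let t := tree_of B in rewrite (@hat_comp C s t u g f Z)
  | |- context [@hat ?C _ _ (tenm _ _) _] => rewrite hat_ten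
  end;
  rewrite ?hatM ?hatE /= ?nfm_id ?tenm1 ?comp1m ?compm1.

Ltac strict :=
  match goal with |- @eq (@hom _ ?A ?B) _ _ =>
    let s := tree_of A in let t := tree_of B in
    apply: (@hat_inj _ s t) => Z; push
  end.

Ltac strictify H Z :=
  match type of H with @eq (@hom _ ?A ?B) _ _ =>
    let s := tree_of A in let t := tree_of B in
    move: (f_equal (fun f => @hat _ s t f Z) H) => /=; push
  end.

(** * Algebra and module axioms in strictified form *)

Section AlgebraHat.
Context (C : moncat) (R : algebra C).
Implicit Types Z : C.

Lemma mulAh Z : h21 (mul R) Z ∘ h21 (mul R) (R ⊗ Z)
  = h21 (mul R) Z ∘ (Id R ⊠ h21 (mul R) Z).
Proof. strictify (mulA R) Z. by []. Qed.

Lemma lactAh Y (s : lmod_str R Y) Z : h21 (lact s) Z ∘ h21 (mul R) (Y ⊗ Z)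
  = h21 (lact s) Z ∘ (Id R ⊠ h21 (lact s) Z).
Proof. by strictify (lactA s) Z. Qed.

Lemma lact1h Y (s : lmod_str R Y) Z :
  h21 (lact s) Z ∘ h01 (eta R) (Y ⊗ Z) = Id (Y ⊗ Z).
Proof. by strictify (lact1 s) Z. Qed.

Lemma ractAh Y (s : rmod_str R Y) Z : h21 (ract s) Z ∘ h21 (ract s) (R ⊗ Z)
  = h21 (ract s) Z ∘ (Id Y ⊠ h21 (mul R) Z).
Proof. by strictify (ractA s) Z. Qed.

Lemma ract1h Y (s : rmod_str R Y) Z :
  h21 (ract s) Z ∘ (Id Y ⊠ h01 (eta R) Z) = Id (Y ⊗ Z).
Proof. by strictify (ract1 s) Z. Qed.

Lemma bcommh Y (s : bimod_str R Y) Z :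
  h21 (ract s) Z ∘ h21 (lact s) (R ⊗ Z)
  = h21 (lact s) Z ∘ (Id R ⊠ h21 (ract s) Z).
Proof. by strictify (bcomm s) Z. Qed.

End AlgebraHat.

(** * Mates and Frobenius algebras *)

Section Mate.
Context (C : moncat) (X Y : C) (rho : hom 𝟙 (X ⊗ Y)) (lam : hom (Y ⊗ X) 𝟙)
  (adj : adjunction rho lam).

Lemma adjXh Z : (Id X ⊠ h20 lam Z) ∘ h02 rho (X ⊗ Z) = Id (X ⊗ Z).
Proof. by strictify (adj_X adj) Z. Qed.

Lemma adjYh Z : h20 lam (Y ⊗ Z) ∘ (Id Y ⊠ h02 rho Z) = Id (Y ⊗ Z).
Proof. by strictify (adj_Y adj) Z. Qed.

(** The bijection between morphisms [Y ⊗ A -> 𝟙] and [A -> X] given by the adjunction. It allows an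
    action on [X] to be prescribed by its pairing with [Y]. *)
Definition mate A (f : hom (Y ⊗ A) 𝟙) : hom A X :=
  run X ∘ (Id X ⊠ f) ∘ ass X Y A ∘ (rho ⊠ Id A) ∘ luni A.

Lemma mateE A (f : hom (Y ⊗ A) 𝟙) : lam ∘ (Id Y ⊠ mate f) = f.
Proof.
rewrite /mate.
apply: (@hat_inj _ (Node (Leaf Y) (Leaf A)) Unit) => Z; push.
by rewrite wl compA -(nat20 lam) -compA adjYh compm1.
Qed.

Lemma mate_inj A (g h : hom A X) :
  lam ∘ (Id Y ⊠ g) = lam ∘ (Id Y ⊠ h) -> g = h.
Proof.
move=> E; apply: (@hat_inj _ (Leaf A) (Leaf X)) => Z.
have {}E : h20 lam Z ∘ (Id Y ⊠ h11 g Z) = h20 lam Z ∘ (Id Y ⊠ h11 h Z).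
  by move: (f_equal (fun f => @hat _ (Node (Leaf Y) (Leaf A)) Unit f Z) E); push.
(* A triangle identity rebuilds [k] from its pairing with [Y]: [k(a) = x_i λ(y_i, k(a))]. *)
have recover (k : hom A X) : h11 k Z
    = (Id X ⊠ (h20 lam Z ∘ (Id Y ⊠ h11 k Z))) ∘ h02 rho (A ⊗ Z).
  by rewrite wl -compA nat02 compA adjXh comp1m.
by rewrite !hatE recover E -recover.
Qed.
End Mate.

Section Frobenius.
Context (C : moncat) (R : algebra C) (theta : hom R 𝟙) (e : hom 𝟙 (R ⊗ R))
  (fp : frobenius_pair theta e) (alpha : hom 𝟙 R)
  (halpha : mul R ∘ (mul R ⊠ Id R) ∘ ((Id R ⊠ alpha) ⊠ Id R)
            ∘ (runi R ⊠ Id R) ∘ e = eta R).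
Implicit Types Z : C.

Local Notation m Z := (h21 (mul R) Z).
Local Notation u Z := (h01 (eta R) Z).
Local Notation a Z := (h01 alpha Z).
Local Notation t Z := (h10 theta Z).
Local Notation c Z := (h02 e Z).

Lemma mul1mh Z : m Z ∘ u (R ⊗ Z) = Id (R ⊗ Z).
Proof. exact: (lact1h (lmod_reg R)). Qed.

Lemma mulm1h Z : m Z ∘ (Id R ⊠ u Z) = Id (R ⊗ Z).
Proof. exact: (ract1h (rmod_reg R)). Qed.

Lemma casimirh Z : m (R ⊗ Z) ∘ (Id R ⊠ c Z) = (Id R ⊠ m Z) ∘ c (R ⊗ Z).
Proof. by strictify (frob_casimir fp) Z. Qed.

Lemma frob_lh Z : t (R ⊗ Z) ∘ c Z = u Z.
Proof. by strictify (frob_l fp) Z. Qed.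

Lemma frob_rh Z : (Id R ⊠ t Z) ∘ c Z = u Z.
Proof. by strictify (frob_r fp) Z. Qed.

Lemma separableh Z :
  m Z ∘ m (R ⊗ Z) ∘ (Id R ⊠ a (R ⊗ Z)) ∘ c Z = u Z.
Proof. by strictify halpha Z. Qed.

(** By the Casimir property, [e1 ϑ(e2 s) = s e1 ϑ(e2) = s]. *)
Lemma casimir_trace Z : (Id R ⊠ (t Z ∘ m Z)) ∘ c (R ⊗ Z) = Id (R ⊗ Z).
Proof.
rewrite wl -compA -casimirh compA (nat21 (mul R) (t Z)) -compA -wl frob_rh.
exact: mulm1h.
Qed.

(** Associativity turns [e1 (α (e2 s))] into [(e1 α e2) s]. *)
Lemma separable_casimir Z :
  m Z ∘ (Id R ⊠ (m Z ∘ a (R ⊗ Z) ∘ m Z)) ∘ c (R ⊗ Z) = Id (R ⊗ Z).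
Proof.
rewrite -(compA (m Z) (a (R ⊗ Z))) -(nat01 alpha (m Z)) !wl !compA -mulAh.
rewrite (rea (esym (nat21 (mul R) (m Z)))) !compA -mulAh.
by rewrite -3!(compA (m Z)) separableh mul1mh.
Qed.

End Frobenius.

(** * Lifting the adjunction, before passing to quotients *)

(* The part of an adjunction between bimodules that can be expressed without
   tensor products over [R]: [rt] and [lt] play the roles of [ρ'] and [λ']. *)
Record lifted_adjunction (C : moncat) (R : algebra C) (X Y : C)
    (sX : bimod_str R X) (sY : bimod_str R Y)
    (rt : hom R (X ⊗ Y)) (lt : hom (Y ⊗ X) R) : Prop := {
  lifted_rho_l : rt ∘ mul R = (lact sX ⊠ Id Y) ∘ assi R X Y ∘ (Id R ⊠ rt);
  lifted_rho_r : rt ∘ mul R = (Id X ⊠ ract sY) ∘ ass X Y R ∘ (rt ⊠ Id R);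
  lifted_lam_balanced :
    lt ∘ (ract sY ⊠ Id X) = lt ∘ (Id Y ⊠ lact sX) ∘ ass Y R X;
  lifted_lam_l : lt ∘ (lact sY ⊠ Id X) ∘ assi R Y X = mul R ∘ (Id R ⊠ lt);
  lifted_lam_r : lt ∘ (Id Y ⊠ ract sX) ∘ ass Y X R = mul R ∘ (lt ⊠ Id R);
  lifted_adj_X : ract sX ∘ (Id X ⊠ lt) ∘ ass X Y X ∘ ((rt ∘ eta R) ⊠ Id X)
    ∘ luni X = Id X;
  lifted_adj_Y : lact sY ∘ (lt ⊠ Id Y) ∘ assi Y X Y ∘ (Id Y ⊠ (rt ∘ eta R))
    ∘ runi Y = Id Y }.

Section Lift.
Context (C : moncat) (R : algebra C) (theta : hom R 𝟙) (e : hom 𝟙 (R ⊗ R))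
  (fp : frobenius_pair theta e) (alpha : hom 𝟙 R)
  (halpha : mul R ∘ (mul R ⊠ Id R) ∘ ((Id R ⊠ alpha) ⊠ Id R)
            ∘ (runi R ⊠ Id R) ∘ e = eta R)
  (X Y : C) (rho : hom 𝟙 (X ⊗ Y)) (lam : hom (Y ⊗ X) 𝟙)
  (adj : adjunction rho lam) (sY : bimod_str R Y).
Implicit Types Z : C.

Local Notation m Z := (h21 (mul R) Z).
Local Notation u Z := (h01 (eta R) Z).
Local Notation a Z := (h01 alpha Z).
Local Notation t Z := (h10 theta Z).
Local Notation c Z := (h02 e Z).
Local Notation l Z := (h21 (lact sY) Z).
Local Notation r Z := (h21 (ract sY) Z).
Local Notation lm Z := (h20 lam Z).
Local Notation rh Z := (h02 rho Z).

Definition lift_rho : hom R (X ⊗ Y) :=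
  (Id X ⊠ (lact sY ∘ (Id R ⊠ ract sY)))
  ∘ (Id X ⊠ (alpha ⊠ Id (Y ⊗ R)))
  ∘ (Id X ⊠ luni (Y ⊗ R))
  ∘ ass X Y R
  ∘ (rho ⊠ Id R)
  ∘ luni R.

Definition lift_lam : hom (Y ⊗ X) R :=
  run R
  ∘ (Id R ⊠ lam)
  ∘ (Id R ⊠ (lact sY ⊠ Id X))
  ∘ (Id R ⊠ assi R Y X)
  ∘ ass R R (Y ⊗ X)
  ∘ (e ⊠ Id (Y ⊗ X))
  ∘ luni (Y ⊗ X).

(** Applying [ϑ] to the balancing condition [λ'(y r, x) = λ'(y, r x)], with [ϑ λ' = λ], leaves this
    as the only candidate. *)
Definition dual_lact : hom (R ⊗ X) X :=
  mate rho (lam ∘ (ract sY ⊠ Id X) ∘ assi Y R X).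

(** Forced in the same way by right linearity, [λ'(y, x r) = λ'(y, x) r]. *)
Definition dual_ract : hom (X ⊗ R) X :=
  mate rho (theta ∘ mul R ∘ (lift_lam ⊠ Id R) ∘ assi Y X R).

Local Notation L Z := (h21 lift_lam Z).
Local Notation P Z := (h12 lift_rho Z).
Local Notation dl Z := (h21 dual_lact Z).
Local Notation dr Z := (h21 dual_ract Z).

Lemma lift_rhoh Z :
  P Z = (Id X ⊠ (l Z ∘ a (Y ⊗ Z) ∘ r Z)) ∘ rh (R ⊗ Z).
Proof.
rewrite /h12 /lift_rho; push.
by rewrite -[in RHS](compA (l Z)) -(nat01 alpha (r Z)) -wl compA.
Qed.

Lemma lift_lamh Z :
  L Z = (Id R ⊠ (lm Z ∘ l (X ⊗ Z))) ∘ c (Y ⊗ X ⊗ Z).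
Proof. by rewrite {1}/h21 /lift_lam; push; rewrite wl. Qed.

Lemma dual_lacth Z : lm Z ∘ (Id Y ⊠ dl Z) = lm Z ∘ r (X ⊗ Z).
Proof.
have := mateE adj (lam ∘ (ract sY ⊠ Id X) ∘ assi Y R X).
rewrite -/dual_lact => E.
by strictify E Z.
Qed.

Lemma dual_racth Z : lm Z ∘ (Id Y ⊠ dr Z) = t Z ∘ m Z ∘ L (R ⊗ Z).
Proof.
have := mateE adj (theta ∘ mul R ∘ (lift_lam ⊠ Id R) ∘ assi Y X R).
rewrite -/dual_ract => E.
by strictify E Z.
Qed.

(** The two actions on [Y] commute, so [e1 λ(e2 (y r), x) = e1 λ((e2 y) r, x) = e1 λ(e2 y, r x)]. *)
Lemma lift_lam_balancedh Z : L Z ∘ r (X ⊗ Z) = L Z ∘ (Id Y ⊠ dl Z).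
Proof.
rewrite !lift_lamh -!compA -!(nat02 e) !compA -!wl.
rewrite -(compA _ _ (Id R ⊠ r _)) -bcommh !compA -dual_lacth.
by rewrite -!compA (nat21 (lact sY)).
Qed.

(** By the Casimir property, [e1 λ((e2 s) y, x) = s e1 λ(e2 y, x)]. *)
Lemma lift_lam_lh Z : L Z ∘ l (X ⊗ Z) = m Z ∘ (Id R ⊠ L Z).
Proof.
rewrite !lift_lamh [in RHS]wl !compA -(nat21 (mul R)) (rea (casimirh fp _)).
rewrite -compA -(nat02 e) !compA -!wl.
by rewrite -compA -lactAh compA.
Qed.

Lemma trace_lift_lamh Z : t Z ∘ L Z = lm Z.
Proof.
by rewrite lift_lamh compA -nat10 -compA (frob_lh fp) -compA lact1h compm1.
Qed.

(** Left linearity gives [e1 λ(e2 y, x r) = e1 ϑ(λ'(e2 y, x) r) = e1 ϑ(e2 λ'(y, x) r)], and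
    [casimir_trace] concludes. *)
Lemma lift_lam_rh Z : L Z ∘ (Id Y ⊠ dr Z) = m Z ∘ L (R ⊗ Z).
Proof.
rewrite lift_lamh -compA -(nat02 e) compA -wl -compA -(nat21 (lact sY)) compA.
rewrite dual_racth -compA lift_lam_lh compA wl -compA (nat02 e).
rewrite -(compA (t Z)) mulAh !compA.
rewrite wl -(compA (Id R ⊠ (t Z ∘ m Z))) (nat02 e) !compA.
by rewrite (casimir_trace fp) comp1m.
Qed.

Lemma lift_rho_unith Z :
  P Z ∘ u Z = (Id X ⊠ (l Z ∘ a (Y ⊗ Z))) ∘ rh Z.
Proof.
rewrite lift_rhoh -compA -(nat02 rho) compA -wl.
by rewrite (rea (ract1h _ _)) compm1.
Qed.

(** A triangle identity reduces [e1 λ(e2 y, x_i) ⊗ y_i] to [e1 ⊗ e2 y]. *)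
Lemma lift_lam_rhoh Z :
  L (Y ⊗ Z) ∘ (Id Y ⊠ rh Z) = (Id R ⊠ l Z) ∘ c (Y ⊗ Z).
Proof.
rewrite lift_lamh -compA -(nat02 e) compA -wl -compA -(nat21 (lact sY)) compA.
by rewrite (adjYh adj) comp1m.
Qed.

(** [λ'(y, x_i) α y_i = e1 α e2 y = y], the last equality by the choice of [alpha]. *)
Lemma lift_adj_Yh Z :
  l Z ∘ L (Y ⊗ Z) ∘ (Id Y ⊠ (P Z ∘ u Z)) = Id (Y ⊗ Z).
Proof.
rewrite lift_rho_unith wl compA -(compA (l Z)) -(nat21 lift_lam).
rewrite compA -compA lift_lam_rhoh !wl !compA -lactAh.
rewrite -(compA _ (Id R ⊠ a _)) -wl -(nat01 alpha (l Z)) wl !compA.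
rewrite (rea (esym (nat21 (mul R) (l Z)))) !compA -lactAh -3!(compA (l Z)).
by rewrite (separableh halpha) lact1h.
Qed.

Lemma lift_adj_Xh Z :
  dr Z ∘ (Id X ⊠ L Z) ∘ (P (X ⊗ Z) ∘ u (X ⊗ Z)) = Id (X ⊗ Z).
Proof.
(* Pairing with [y] gives [ϑ(λ'(y, x_i) λ'(α y_i, x)) = ϑ(e1 α e2 λ'(y, x)) = ϑ(λ'(y, x)) = λ(y,
   x)]. *)
have E : lm Z ∘ (Id Y ⊠ (dr Z ∘ (Id X ⊠ L Z) ∘ (P (X ⊗ Z) ∘ u (X ⊗ Z)))) = lm Z.
  rewrite lift_rho_unith !compA -(compA (dr Z)) -wl 2!wl !compA dual_racth.
  rewrite (rea (esym (nat21 lift_lam _))) !compA -compA lift_lam_rhoh compA.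
  rewrite -(compA _ (Id R ⊠ _) (Id R ⊠ _)) -wl.
  have -> : L Z ∘ l (X ⊗ Z) ∘ a (Y ⊗ X ⊗ Z) ∘ l (X ⊗ Z)
    = m Z ∘ a (R ⊗ Z) ∘ m Z ∘ (Id R ⊠ L Z).
    by rewrite lift_lam_lh -(compA (m Z)) (nat01 alpha) -!compA lift_lam_lh.
  rewrite wl compA -compA (nat02 e) compA -(compA (t Z)).
  rewrite -2!(compA (t Z)) (separable_casimir halpha) comp1m.
  exact: trace_lift_lamh.
(* A triangle identity undoes the pairing. *)
by rewrite -[LHS]comp1m -(adjXh adj Z) -compA -(nat02 rho) compA -wl E.
Qed.

(** The axioms of the dual actions are checked after pairing with [Y]; here associativity of the
    right action on [Y] is what remains. *)
Fact dual_lactA :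
  dual_lact ∘ (mul R ⊠ Id X) = dual_lact ∘ (Id R ⊠ dual_lact) ∘ ass R R X.
Proof.
apply: (mate_inj adj); strict; rewrite !wl !compA dual_lacth -[RHS]compA.
by rewrite -(nat21 (ract sY)) compA dual_lacth -!compA ractAh.
Qed.

Fact dual_lact1 : dual_lact ∘ (eta R ⊠ Id X) = lun X.
Proof.
apply: (mate_inj adj); strict; rewrite wl compA dual_lacth.
by rewrite -compA ract1h compm1.
Qed.

(** Both sides pair to [ϑ(λ'(y, x) r s)]. Right linearity of [λ'] may be used, since it rests on the
    defining pairing of [dual_ract] alone. *)
Fact dual_ractA :
  dual_ract ∘ (dual_ract ⊠ Id R) = dual_ract ∘ (Id X ⊠ mul R) ∘ ass X R R.
Proof.
apply: (mate_inj adj); strict; rewrite !wl !compA !dual_racth -compA lift_lam_rh.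
by rewrite -[RHS]compA -(nat21 lift_lam) !compA -!(compA (t _)) mulAh.
Qed.

Fact dual_ract1 : dual_ract ∘ (Id X ⊠ eta R) = run X.
Proof.
apply: (mate_inj adj); strict; rewrite wl compA dual_racth.
by rewrite -compA -(nat21 lift_lam) !compA -(compA (t _)) mulm1h compm1
  trace_lift_lamh.
Qed.

Definition dual_lmod : lmod_str R X := LmodStr dual_lactA dual_lact1.
Definition dual_rmod : rmod_str R X := RmodStr dual_ractA dual_ract1.

(** Both sides pair to [ϑ(λ'(y s, x) r)], as [λ'] is balanced. *)
Fact dual_bcomm : ract dual_rmod ∘ (lact dual_lmod ⊠ Id R)
  = lact dual_lmod ∘ (Id R ⊠ ract dual_rmod) ∘ ass R X R.
Proof.
apply: (mate_inj adj) => /=; strict; rewrite !wl !compA dual_racth dual_lacth.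
rewrite -compA -lift_lam_balancedh -[RHS]compA -(nat21 (ract sY)).
by rewrite !compA dual_racth.
Qed.

Definition dual_bimod : bimod_str R X := BimodStr dual_bcomm.

(** The actions are mates, so [r x_i ⊗ y_i = x_i ⊗ y_i r]; this yields left linearity of [ρ']. *)
Lemma dual_lact_rhoh Z :
  dl (Y ⊗ Z) ∘ (Id R ⊠ rh Z) = (Id X ⊠ r Z) ∘ rh (R ⊗ Z).
Proof.
have -> : dl (Y ⊗ Z)
  = (Id X ⊠ (lm (Y ⊗ Z) ∘ r (X ⊗ Y ⊗ Z))) ∘ rh (R ⊗ X ⊗ Y ⊗ Z).
  by rewrite -dual_lacth wl -compA nat02 compA (adjXh adj) comp1m.
rewrite -compA -(nat02 rho) compA -wl -compA -(nat21 (ract sY)) compA.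
by rewrite (adjYh adj) comp1m.
Qed.

Lemma lift_rho_mulh Z :
  P Z ∘ m Z = (Id X ⊠ (l Z ∘ a (Y ⊗ Z) ∘ r Z ∘ r (R ⊗ Z))) ∘ rh (R ⊗ R ⊗ Z).
Proof.
by rewrite lift_rhoh -compA -(nat02 rho) compA -wl -compA -ractAh !compA.
Qed.

Lemma lift_lifted : lifted_adjunction dual_bimod sY lift_rho lift_lam.
Proof.
split=> /=.
- strict; rewrite lift_rho_mulh lift_rhoh [Id R ⊠ _]wl compA -(nat21 dual_lact).
  by rewrite (rea (dual_lact_rhoh _)) compA -wl.
- strict; rewrite lift_rho_mulh !lift_rhoh compA -wl !compA bcommh.
  by rewrite (rea (nat01 alpha _)) compA.
- strict; exact: lift_lam_balancedh.
- strict; exact: lift_lam_lh.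
- strict; exact: lift_lam_rh.
- by strict; rewrite -lift_adj_Xh !compA.
- strict; exact: lift_adj_Yh.
Qed.
End Lift.

(** * Passing to the tensor product over R *)

Section Assembly.
Context (C : moncat) (cq : has_coequalizers C)
  (cfl : forall X : C, coflat X) (R : algebra C) (X Y : C)
  (sX : bimod_str R X) (sY : bimod_str R Y)
  (rt : hom R (X ⊗ Y)) (lt : hom (Y ⊗ X) R)
  (lifted : lifted_adjunction sX sY rt lt).

Let BX : bimod R := Bimod sX.
Let BY : bimod R := Bimod sY.
Let R0 : bimod R := bimod_reg R.
Local Notation p X Y := (quoB cq cfl X Y).
Local Notation bt X Y := (tenB cq cfl X Y).
Local Notation BC := (bimod_moncat cq cfl R).

Fact quo_rho_l : (p BX BY ∘ rt) ∘ lact R0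
  = lact (bt BX BY) ∘ (Id R ⊠ (p BX BY ∘ rt)).
Proof.
rewrite wl compA (lactE cq cfl BX BY) -compA (lifted_rho_l lifted) /=.
by rewrite !compA.
Qed.

Fact quo_rho_r : (p BX BY ∘ rt) ∘ ract R0
  = ract (bt BX BY) ∘ ((p BX BY ∘ rt) ⊠ Id R).
Proof.
rewrite wr compA (ractE cq cfl BX BY) -compA (lifted_rho_r lifted) /=.
by rewrite !compA.
Qed.

Definition quo_rho : bimod_hom R0 (bt BX BY) :=
  @BimodHom C R R0 (bt BX BY) (p BX BY ∘ rt) quo_rho_l quo_rho_r.

Lemma quo_rhoE : bfun quo_rho = p BX BY ∘ rt.
Proof. by []. Qed.

Definition quo_lam_fun : hom (bt BY BX) R :=
  descB cq cfl (X := BY) (Y := BX) (lifted_lam_balanced lifted).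

Lemma quo_lam_funE : quo_lam_fun ∘ p BY BX = lt.
Proof. exact: descBE. Qed.

Fact quo_lam_l : quo_lam_fun ∘ lact (bt BY BX) = lact R0 ∘ (Id R ⊠ quo_lam_fun).
Proof.
(* Coflatness keeps the tensored quotient map a coequalizer, so it can be cancelled. *)
have e : epi (Id R ⊠ p BY BX)
  by apply: regepi_epi; apply: reg_l => //; exact: reg_p.
apply: e; rewrite (rea (lactE cq cfl BY BX)) compA quo_lam_funE.
rewrite (rea (esym (wl _ _ _))) quo_lam_funE compA.
exact: lifted_lam_l lifted.
Qed.

Fact quo_lam_r : quo_lam_fun ∘ ract (bt BY BX) = ract R0 ∘ (quo_lam_fun ⊠ Id R).
Proof.
have e : epi (p BY BX ⊠ Id R)
  by apply: regepi_epi; apply: reg_r => //; exact: reg_p.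
apply: e; rewrite (rea (ractE cq cfl BY BX)) compA quo_lam_funE.
rewrite (rea (esym (wr _ _ _))) quo_lam_funE compA.
exact: lifted_lam_r lifted.
Qed.

Definition quo_lam : bimod_hom (bt BY BX) R0 :=
  @BimodHom C R (bt BY BX) R0 quo_lam_fun quo_lam_l quo_lam_r.

(** [bluni_fun] introduces a quotient map, which is carried through each factor by its defining
    equation until [brun_fun] turns it into the right action on [X]. *)
Lemma quo_adj_X :
  brun_fun cq cfl BX ∘ btenm_fun cq cfl (bid BX) quo_lam
  ∘ bass_fun cq cfl BX BY BX ∘ btenm_fun cq cfl quo_rho (bid BX)
  ∘ bluni_fun cq cfl BX = Id X.
Proof.
rewrite /bluni_fun !compA (rea (btenm_funE _ _ _ _)) bidE quo_rhoE wr !compA.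
rewrite -(compA _ (bass_fun _ _ _ _ _)) (rea (bass_funE _ _ _ _ _)) !compA.
rewrite (rea (btenm_funE _ _ _ _)) !compA (brun_funE _ _ BX) bidE.
rewrite (rea (esym (wl _ _ _))) quo_lam_funE.
by rewrite -(compA _ (rt ⊠ _)) -wr; exact: lifted_adj_X lifted.
Qed.

Lemma quo_adj_Y :
  blun_fun cq cfl BY ∘ btenm_fun cq cfl quo_lam (bid BY)
  ∘ bassi_fun cq cfl BY BX BY ∘ btenm_fun cq cfl (bid BY) quo_rho
  ∘ bruni_fun cq cfl BY = Id Y.
Proof.
rewrite /bruni_fun !compA (rea (btenm_funE _ _ _ _)) bidE quo_rhoE wl !compA.
rewrite -(compA _ (bassi_fun _ _ _ _ _)) (rea (bassi_funE _ _ _ _ _)) !compA.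
rewrite (rea (btenm_funE _ _ _ _)) !compA (blun_funE _ _ BY) bidE.
rewrite (rea (esym (wr _ _ _))) quo_lam_funE.
by rewrite -(compA _ (_ ⊠ rt)) -wl; exact: lifted_adj_Y lifted.
Qed.

Lemma quo_adjunction : @adjunction BC BY BX quo_rho quo_lam.
Proof.
split; apply: bimod_hom_eq.
- exact: quo_adj_X.
- exact: quo_adj_Y.
Qed.

Lemma lifted_bimod_adjunction :
  let BX : BC := Bimod sX in let BY : BC := Bimod sY in
  exists (rho0 : hom 𝟙 (BX ⊗ BY)) (lam0 : hom (BY ⊗ BX) 𝟙),
    bfun rho0 = quoR cq sX sY ∘ rt
    /\ unique (fun f : hom (tenR cq sY sX) R => f ∘ quoR cq sY sX = lt)
         (bfun lam0)
    /\ adjunction rho0 lam0.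
Proof.
exists quo_rho, quo_lam; split=> //; split; last exact: quo_adjunction.
split; first exact: quo_lam_funE.
move=> f fE; apply: (@quoR_epi C cq R Y X sY sX).
by rewrite fE; exact: quo_lam_funE.
Qed.
End Assembly.

(** * Reversing the tensor product *)

Section Reverse.
Context (C : moncat).

Definition rev_moncat : moncat.
Proof.
refine (@Moncat C 𝟙 (fun A B => B ⊗ A) (fun A B A' B' f g => g ⊠ f)
  (fun A B D => assi D B A) (fun A B D => ass D B A) run runi lun luni
  _ _ _ _ _ _ _ _ _ _ _ _ _).
- by move=> *; exact: tenm1.
- by move=> *; exact: tenmM.
- by move=> *; exact: assiK.
- by move=> *; exact: assK.
- by move=> *; exact: runK.
- by move=> *; exact: runiK.
- by move=> *; exact: lunK.
- by move=> *; exact: luniK.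
- by move=> *; exact: assi_nat.
- by move=> *; exact: run_nat.
- by move=> *; exact: lun_nat.
(* Triangle and pentagon now involve inverse associators; after strictification all sides are
   identities. *)
- by move=> A B; strict.
- by move=> A B D E; strict.
Defined.

Context (R : algebra C).

Fact rev_mulA : mul R ∘ (Id R ⊠ mul R) = mul R ∘ (mul R ⊠ Id R) ∘ assi R R R.
Proof. by rewrite mulA -!compA assiK compm1. Qed.

Definition rev_algebra : algebra rev_moncat :=
  @Algebra rev_moncat R (mul R) (eta R) rev_mulA (mulm1 R) (mul1m R).

Local Notation R' := rev_algebra.

Section ToRev.
Context (X : C) (s : bimod_str R X).

Fact rev_lactA :
  ract s ∘ (Id X ⊠ mul R) = ract s ∘ (ract s ⊠ Id R) ∘ assi X R R.
Proof. by rewrite ractA -!compA assiK compm1. Qed.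

Fact rev_ractA :
  lact s ∘ (Id R ⊠ lact s) = lact s ∘ (mul R ⊠ Id X) ∘ assi R R X.
Proof. by rewrite lactA -!compA assiK compm1. Qed.

Definition rev_bimod : @bimod_str rev_moncat R' X :=
  @BimodStr rev_moncat R' X
    (@LmodStr rev_moncat R' X (ract s) rev_lactA (ract1 s))
    (@RmodStr rev_moncat R' X (lact s) rev_ractA (lact1 s)) (bcommE (Bimod s)).
End ToRev.

Section FromRev.
Context (X : C) (s : @bimod_str rev_moncat R' X).

Let lact_s : hom (R ⊗ X) X := ract s.
Let ract_s : hom (X ⊗ R) X := lact s.

Fact unrev_lactA :
  lact_s ∘ (mul R ⊠ Id X) = lact_s ∘ (Id R ⊠ lact_s) ∘ ass R R X.
Proof.
have E : lact_s ∘ (Id R ⊠ lact_s) = lact_s ∘ (mul R ⊠ Id X) ∘ assi R R X.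
  exact: (ractA s).
by rewrite E -!compA assK compm1.
Qed.

Fact unrev_ractA :
  ract_s ∘ (ract_s ⊠ Id R) = ract_s ∘ (Id X ⊠ mul R) ∘ ass X R R.
Proof.
have E : ract_s ∘ (Id X ⊠ mul R) = ract_s ∘ (ract_s ⊠ Id R) ∘ assi X R R.
  exact: (lactA s).
by rewrite E -!compA assK compm1.
Qed.

Fact unrev_bcomm :
  ract_s ∘ (lact_s ⊠ Id R) = lact_s ∘ (Id R ⊠ ract_s) ∘ ass R X R.
Proof.
have E : lact_s ∘ (Id R ⊠ ract_s) = ract_s ∘ (lact_s ⊠ Id R) ∘ assi R X R.
  exact: (bcomm s).
by rewrite E -!compA assK compm1.
Qed.

Definition unrev_bimod : bimod_str R X :=
  @BimodStr C R X (@LmodStr C R X lact_s unrev_lactA (ract1 s))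
    (@RmodStr C R X ract_s unrev_ractA (lact1 s)) unrev_bcomm.
End FromRev.

Lemma rev_frobenius_pair (theta : hom R 𝟙) (e : hom 𝟙 (R ⊗ R)) :
  frobenius_pair theta e -> @frobenius_pair rev_moncat R' theta e.
Proof. by case=> cas fl fr; split=> //; rewrite /= cas. Qed.

(** Reversal makes [X] the left adjoint and exchanges the triangle identities. *)
Lemma rev_adjunction (X Y : C) (rho : hom 𝟙 (X ⊗ Y)) (lam : hom (Y ⊗ X) 𝟙) :
  adjunction rho lam -> @adjunction rev_moncat X Y rho lam.
Proof. by case. Qed.

Lemma rev_separating (e : hom 𝟙 (R ⊗ R)) (alpha : hom 𝟙 R) :
  mul R ∘ (mul R ⊠ Id R) ∘ ((Id R ⊠ alpha) ⊠ Id R) ∘ (runi R ⊠ Id R) ∘ e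
    = eta R ->
  mul R ∘ (Id R ⊠ mul R) ∘ (Id R ⊠ (alpha ⊠ Id R)) ∘ (Id R ⊠ luni R) ∘ e
    = eta R.
Proof. by move=> <-; strict; rewrite mulAh. Qed.

Lemma unrev_lifted (X Y : C) (sX : bimod_str R X)
    (sY : @bimod_str rev_moncat R' Y) (rt : hom R (X ⊗ Y))
    (lt : hom (Y ⊗ X) R) :
  @lifted_adjunction rev_moncat R' Y X sY (rev_bimod sX) rt lt ->
  lifted_adjunction sX (unrev_bimod sY) rt lt.
Proof.
case=> rl rr bal ll lr aX aY; split=> //.
(* The other conditions correspond by conversion, left and right being exchanged; the reversed
   balancing condition carries the inverse associator. *)
have E : lt ∘ (Id Y ⊠ lact sX)
  = lt ∘ (ract (unrev_bimod sY) ⊠ Id X) ∘ assi Y R X by exact: bal.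
by rewrite E -!compA assK compm1.
Qed.

(** After reversal the left action is applied before the right one; [bcomm] restores the order used
    in (ii). *)
Lemma rev_lift_rho (alpha : hom 𝟙 R) (X Y : C) (rho : hom 𝟙 (X ⊗ Y))
    (sX : bimod_str R X) :
  (@lift_rho rev_moncat R' alpha Y X rho (rev_bimod sX) : hom R (X ⊗ Y))
  = ((lact sX ∘ (Id R ⊠ ract sX)) ⊠ Id Y)
    ∘ (ass R X R ⊠ Id Y)
    ∘ ((Id (R ⊗ X) ⊠ alpha) ⊠ Id Y)
    ∘ (runi (R ⊗ X) ⊠ Id Y)
    ∘ assi R X Y
    ∘ (Id R ⊠ rho)
    ∘ runi R.
Proof. by rewrite -wr -bcomm. Qed.

End Reverse.

Theorem proposition5p8
  (C : moncat) (cq : has_coequalizers C)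
  (cfl : forall X : C, coflat X)
  (robust : forall (S : algebra C) (Y : C) (sY : lmod_str S Y),
    left_robust cq sY)
  (R : algebra C) (frob : frobenius R) (sep : separable R)
  (vartheta : hom R 𝟙) (e : hom 𝟙 (R ⊗ R)) (fp : frobenius_pair vartheta e)
  (alpha : hom 𝟙 R)
  (halpha : mul R ∘ (mul R ⊠ Id R) ∘ ((Id R ⊠ alpha) ⊠ Id R)
            ∘ (runi R ⊠ Id R) ∘ e = eta R)
  (X Y : C) (rho : hom 𝟙 (X ⊗ Y)) (lam : hom (Y ⊗ X) 𝟙)
  (adj : adjunction rho lam) :
  (forall sY : bimod_str R Y, exists sX : bimod_str R X,
    let BX : bimod_moncat cq cfl R := Bimod sX in
    let BY : bimod_moncat cq cfl R := Bimod sY in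
    exists (rho0 : hom 𝟙 (BX ⊗ BY)) (lam0 : hom (BY ⊗ BX) 𝟙),
      bfun rho0
        = quoR cq sX sY
          ∘ (Id X ⊠ (lact sY ∘ (Id R ⊠ ract sY)))
          ∘ (Id X ⊠ (alpha ⊠ Id (Y ⊗ R)))
          ∘ (Id X ⊠ luni (Y ⊗ R))
          ∘ ass X Y R
          ∘ (rho ⊠ Id R)
          ∘ luni R
      /\ unique (fun f : hom (tenR cq sY sX) R =>
           f ∘ quoR cq sY sX
           = run R
             ∘ (Id R ⊠ lam)
             ∘ (Id R ⊠ (lact sY ⊠ Id X))
             ∘ (Id R ⊠ assi R Y X)
             ∘ ass R R (Y ⊗ X)
             ∘ (e ⊠ Id (Y ⊗ X))
             ∘ luni (Y ⊗ X)) (bfun lam0)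
      /\ adjunction rho0 lam0)
  /\
  (forall sX : bimod_str R X, exists sY : bimod_str R Y,
    let BX : bimod_moncat cq cfl R := Bimod sX in
    let BY : bimod_moncat cq cfl R := Bimod sY in
    exists (rho0 : hom 𝟙 (BX ⊗ BY)) (lam0 : hom (BY ⊗ BX) 𝟙),
      bfun rho0
        = quoR cq sX sY
          ∘ ((lact sX ∘ (Id R ⊠ ract sX)) ⊠ Id Y)
          ∘ (ass R X R ⊠ Id Y)
          ∘ ((Id (R ⊗ X) ⊠ alpha) ⊠ Id Y)
          ∘ (runi (R ⊗ X) ⊠ Id Y)
          ∘ assi R X Y
          ∘ (Id R ⊠ rho)
          ∘ runi R
      /\ unique (fun f : hom (tenR cq sY sX) R =>
           f ∘ quoR cq sY sX
           = lun R
             ∘ (lam ⊠ Id R)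
             ∘ ((Id Y ⊠ ract sX) ⊠ Id R)
             ∘ (ass Y X R ⊠ Id R)
             ∘ assi (Y ⊗ X) R R
             ∘ (Id (Y ⊗ X) ⊠ e)
             ∘ runi (Y ⊗ X)) (bfun lam0)
      /\ adjunction rho0 lam0).
Proof.
split=> [sY|sX].
- exists (dual_bimod fp adj sY).
  have [rho0 [lam0 [Erho ?]]] :=
    lifted_bimod_adjunction cq cfl (lift_lifted fp halpha adj sY).
  by exists rho0, lam0; split=> //; rewrite Erho /lift_rho !compA.
(* In the reversed category [X] is left adjoint to [Y], so the construction of (i) puts a bimodule
   structure on [Y]. Its [λ'] is that of (ii) by conversion. *)
- have lifted := lift_lifted (rev_frobenius_pair fp)
    (rev_separating halpha : _ = eta (rev_algebra R)) (rev_adjunction adj)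
    (rev_bimod sX).
  exists (unrev_bimod (dual_bimod (rev_frobenius_pair fp) (rev_adjunction adj)
    (rev_bimod sX))).
  have [rho0 [lam0 [Erho ?]]] :=
    lifted_bimod_adjunction cq cfl (unrev_lifted lifted).
  exists rho0, lam0; split=> //.
  by rewrite Erho rev_lift_rho !compA.
Qed.
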